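(* Let $r\ge 1$, $m\in\{1,\dots,r\}$ and $n\ge r$ be integers. Let $I,J\subseteq\{1,\dots,r\}$ with $|I|=|J|=m$ have a (possibly empty) intersection of cardinality $|I\cap J|=c\ge 0$. If $W\sim\mathcal{W}_r(n,I_r)$, then $\det(W_{I\times J})$ has the same distribution as $$\Big(\prod_{i=1}^{c}W_i\Big)\Big(\prod_{i=c+1}^{m}\sqrt{W_i}\Big)\det(Z),$$ where $W_i$, $i=1,\dots,m$, are independent $\chi^2_{n-i+1}$ random variables and $Z=(Z_{ij})\in\mathbb{R}^{(m-c)\times(m-c)}$ is a random matrix of independent $\mathcal{N}(0,1)$ random variables that are also independent of $(W_1,\dots,W_m)$. In particular, $$\mathrm{E}[\det(W_{I\times J})^2]=\frac{n!}{(n-m)!}\,\frac{(n+2)!}{(n+2-|I\cap J|)!}\,(m-|I\cap J|)!$$ and $$\mathrm{Var}[\det(W_{I\times J})]=\begin{cases}\dfrac{n!}{(n-m)!}\left[\dfrac{(n+2)!}{(n+2-m)!}-\dfrac{n!}{(n-m)!}\right], & \text{if } I=J,\\[2ex] \dfrac{n!}{(n-m)!}\,\dfrac{(n+2)!}{(n+2-|I\cap J|)!}\,(m-|I\cap J|)!, & \text{if } |I\cap J|<m.\end{cases}$$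
   Context: The Wishart distribution $\mathcal{W}_r(n,I_r)$ is the law of $XX^T$, where $X\in\mathbb{R}^{r\times n}$ has independent columns each distributed as $\mathcal{N}_r(0,I_r)$, $I_r$ the identity matrix. $W_{I\times J}$ is the submatrix of $W$ with row indices in $I$ and column indices in $J$ (index sets listed in a fixed order, e.g. increasing). The determinant of a $0\times 0$ matrix is $1$ and empty products equal $1$. *)

(* Defs.v *)
From HB Require Import structures.
From mathcomp Require Import all_boot all_order all_algebra.
From mathcomp Require Import all_classical all_reals all_analysis.
Import Order.TTheory GRing.Theory Num.Theory.
Import numFieldNormedType.Exports.

Set Implicit Arguments.
Unset Strict Implicit.
Unset Printing Implicit Defensive.

Local Open Scope classical_set_scope.
Local Open Scope ring_scope.

(* Matrices carry the product sigma-algebra, i.e. the one generated by the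
   entries; over the reals this is the Borel sigma-algebra. *)
Section measurable_matrix.
Context {d : measure_display} {T : measurableType d} (m n : nat).

Definition mx_cylinders : set (set 'M[T]_(m, n)) :=
  [set B | exists i j, exists2 A : set T,
    measurable A & B = (fun M : 'M[T]_(m, n) => M i j) @^-1` A].

Let mx_set0 : <<s mx_cylinders >> set0.
Proof. exact: sigma_algebra0. Qed.

Let mx_setC A : <<s mx_cylinders >> A -> <<s mx_cylinders >> (~` A).
Proof. exact: sigma_algebraC. Qed.

Let mx_bigcup (F : _^nat) : (forall i, <<s mx_cylinders >> (F i)) ->
  <<s mx_cylinders >> (\bigcup_i (F i)).
Proof. exact: sigma_algebra_bigcup. Qed.

HB.instance Definition _ := @isMeasurable.Build (sigma_display mx_cylinders)
  'M[T]_(m, n) <<s mx_cylinders >> mx_set0 mx_setC mx_bigcup.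

Lemma measurable_mx_entry (i : 'I_m) (j : 'I_n) :
  measurable_fun [set: 'M[T]_(m, n)] (fun M => M i j).
Proof.
move=> _ A mA; rewrite setTI; apply: sub_sigma_algebra.
by exists i, j, A.
Qed.

Lemma measurable_fun_mxP d' (T' : measurableType d') (f : T' -> 'M[T]_(m, n)) :
  measurable_fun [set: T'] f <->
  forall i j, measurable_fun [set: T'] (fun x => f x i j).
Proof.
split=> [mf i j|mf].
  exact: (measurableT_comp (measurable_mx_entry i j) mf).
apply: (@measurability _ _ _ _ _ _ mx_cylinders) => //.
move=> _ [_ [i [j [A mA ->]]] <-].
exact: (mf i j).
Qed.

End measurable_matrix.

Section laws.
Context {R : realType}.

Definition has_law d d' (T : measurableType d) (S : measurableType d')
    (P : probability T R) (X : T -> S) (mu : set S -> \bar R) : Prop :=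
  measurable_fun [set: T] X /\
  forall A, measurable A -> pushforward P X A = mu A.

(* The equality is only required on measurable sets, since a probability takes
   unspecified values on the other ones. *)
Definition same_law d1 d2 d' (T1 : measurableType d1) (T2 : measurableType d2)
    (S : measurableType d') (P1 : probability T1 R) (X1 : T1 -> S)
    (P2 : probability T2 R) (X2 : T2 -> S) : Prop :=
  [/\ measurable_fun [set: T1] X1, measurable_fun [set: T2] X2 &
      forall A, measurable A -> pushforward P1 X1 A = pushforward P2 X2 A].

Definition mutually_independent d d' (T : measurableType d)
    (S : measurableType d') (P : probability T R) (I : finType)
    (X : I -> T -> S) : Prop :=
  forall (K : {set I}) (A : I -> set S), (forall i, measurable (A i)) ->
    P (\bigcap_(i in [set` K]) (X i @^-1` A i)) =
    (\prod_(i in K) P (X i @^-1` A i))%E.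

Definition std_normal d (T : measurableType d) (P : probability T R)
    (X : T -> R) : Prop :=
  has_law P X (normal_prob 0 1).

(* N_r(0, I_r) *)
Definition std_normal_vector d (T : measurableType d) (P : probability T R)
    (r : nat) (X : T -> 'cV[R]_r) : Prop :=
  mutually_independent P (fun (i : 'I_r) w => X w i 0) /\
  forall i : 'I_r, std_normal P (fun w => X w i 0).

(* The law of a sum of k squares of independent N(0,1) variables; these need
   not live on the same probability space as X. *)
Definition chi_square d (T : measurableType d) (P : probability T R)
    (k : nat) (X : T -> R) : Prop :=
  exists (d' : measure_display) (T' : measurableType d')
         (P' : probability T' R) (G : 'I_k -> {RV P' >-> R}),
    [/\ mutually_independent P' (fun i => G i : T' -> R),
        forall i, std_normal P' (G i) &
        same_law P X P' (fun w => \sum_(i < k) G i w ^+ 2)].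

(* W_r(n, I_r); again X need not live on the same probability space as W. *)
Definition wishart_id d (T : measurableType d) (P : probability T R)
    (r n : nat) (W : T -> 'M[R]_r) : Prop :=
  exists (d' : measure_display) (T' : measurableType d')
         (P' : probability T' R) (X : {RV P' >-> 'M[R]_(r, n)}),
    [/\ mutually_independent P' (fun (j : 'I_n) w => col j (X w)),
        forall j : 'I_n, std_normal_vector P' (fun w => col j (X w)) &
        same_law P W P' (fun w => X w *m (X w)^T)].

End laws.

(* enum_val lists the elements of a set of ordinals increasingly. *)
Definition submatrix (R : Type) (r m : nat) (I J : {set 'I_r})
    (hI : #|I| = m) (hJ : #|J| = m) (W : 'M[R]_r) : 'M[R]_m :=
  \matrix_(i, j) W (enum_val (cast_ord (esym hI) i))
                   (enum_val (cast_ord (esym hJ) j)).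

(* Main.v *)
Require Import Defs.
From HB Require Import structures.
From mathcomp Require Import all_boot all_order all_algebra.
From mathcomp Require Import all_classical all_reals all_analysis.
From mathcomp Require Import measurable_realfun.
From mathcomp Require Import perm ring lra.
Import Order.TTheory GRing.Theory Num.Theory.
Import numFieldNormedType.Exports.

(** Write [W = X X^T] with [X] an [r x n] matrix of independent [N(0,1)] entries,
    let [A], [B], [C] be the rows of [X] with index in [I :&: J], [I :\: J],
    [J :\: I], and put [k = m - c]. Up to the sign of a reordering of rows and
    columns, the minor is [\det ([A; B] [A; C]^T)], and [A], [B], [C] are
    independent Gaussian matrices ([law_minor]).

    Everything rests on the rotation invariance of Gaussian matrices. Given
    [A], choose a rotation [Q] with [A Q = [L 0]], [L] square. As [B Q] and
    [C Q] have the same law as [B] and [C], these may be replaced by [B Q] and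
    [C Q], and a block factorization gives
    [\det ([A; B] [A; C]^T) = \det (A A^T) * \det (B2 C2^T)], where [B2], [C2]
    consist of the last [n - c] columns of [B Q], [C Q]. The law of the pair
    [(B2, C2)] given [A] does not depend on [A], so that the two factors are
    independent ([law_det_gram2]). Rotating [B2] into [[L 0]] next, one finds
    [\det (B2 C2^T) = \det L * \det Z] with [Z] a [k x k] Gaussian matrix and
    [`|\det L| = Num.sqrt (\det (B2 B2^T))]; the sign of [\det L] disappears
    because [\det Z] is symmetric ([law_det_cross]). Finally, for the first row
    [a] of a Gaussian matrix [A] the same argument splits off the factor [|a|^2]
    from [\det (A A^T)] ([law_det_gramS]); this is a chi-square variable, and
    by induction the Gram determinant of an [l x n] Gaussian matrix is a product
    of independent chi-square variables with [n, n - 1, .., n - l + 1] degrees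
    of freedom ([law_prod_chi]). Together these facts are the representation
    of the minor ([law_minor_product], [law_representation]). The sign of the
    reordering is [1] when [k = 0], and is absorbed by [\det Z] otherwise.

    The moments are computed from the same product: the mean and the second
    moment of [|a|^2] are [n] and [n * (n + 2)], which gives the moments of Gram
    determinants, and [\det Z ^+ 2] is itself the Gram determinant of [Z]. The
    mean of the minor is that of [\det (A A^T)] when [I = J], and it is [0] by
    symmetry when [k > 0].

    Laws are compared through [same_law], which makes it possible to change the
    probability space at each step. Conditioning is Fubini's theorem
    ([same_law_cond]): the matrix [Q] is only chosen for a fixed value of [A],
    so no measurable choice of rotations is involved. Rotation invariance
    itself is reduced to the plane ([normal_rotation]), where a rotation is
    a product of three shears, and shears preserve Lebesgue measure. *)

Set Implicit Arguments.
Unset Strict Implicit.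
Unset Printing Implicit Defensive.
Local Open Scope classical_set_scope.
Local Open Scope ring_scope.

(** * Laws of random elements *)

Section laws.
Context {R : realType}.

(** The pushforward of a probability, bundled as a probability, so that it
    can be used in products and in uniqueness theorems. *)
Definition image_law d d' (T : measurableType d) (S : measurableType d')
    (P : probability T R) (X : T -> S) (mX : measurable_fun [set: T] X) :
    probability S R :=
  distribution P (mfun_Sub (mem_set mX)).

Lemma measurable_preimage d d' (T : measurableType d) (S : measurableType d')
    (f : T -> S) (A : set S) :
  measurable_fun [set: T] f -> measurable A -> measurable (f @^-1` A).
Proof. by move=> mf mA; rewrite -[_ @^-1` _]setTI; exact: mf. Qed.

Lemma same_law_refl d d' (T : measurableType d) (S : measurableType d')
    (P : probability T R) (X : T -> S) :
  measurable_fun [set: T] X -> same_law P X P X.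
Proof. by []. Qed.

Lemma same_law_image d d' (T : measurableType d) (S : measurableType d')
    (P : probability T R) (X : T -> S) (mX : measurable_fun [set: T] X) :
  same_law P X (image_law P mX) id.
Proof. by []. Qed.

Lemma same_law_sym d1 d2 d' (T1 : measurableType d1) (T2 : measurableType d2)
    (S : measurableType d') (P1 : probability T1 R) (X1 : T1 -> S)
    (P2 : probability T2 R) (X2 : T2 -> S) :
  same_law P1 X1 P2 X2 -> same_law P2 X2 P1 X1.
Proof. by case=> m1 m2 h; split => // A mA; rewrite h. Qed.

Lemma same_law_trans d1 d2 d3 d' (T1 : measurableType d1)
    (T2 : measurableType d2) (T3 : measurableType d3) (S : measurableType d')
    (P1 : probability T1 R) (X1 : T1 -> S)
    (P2 : probability T2 R) (X2 : T2 -> S)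
    (P3 : probability T3 R) (X3 : T3 -> S) :
  same_law P1 X1 P2 X2 -> same_law P2 X2 P3 X3 -> same_law P1 X1 P3 X3.
Proof. by move=> [m1 _ h1] [_ m3 h2]; split => // A mA; rewrite h1// h2. Qed.

Lemma same_law_comp d1 d2 d' d'' (T1 : measurableType d1)
    (T2 : measurableType d2) (S : measurableType d') (S' : measurableType d'')
    (P1 : probability T1 R) (X1 : T1 -> S)
    (P2 : probability T2 R) (X2 : T2 -> S) (g : S -> S') :
  measurable_fun [set: S] g ->
  same_law P1 X1 P2 X2 -> same_law P1 (g \o X1) P2 (g \o X2).
Proof.
move=> mg [m1 m2 h]; split; [exact: measurableT_comp..|move=> A mA].
exact: (h (g @^-1` A) (measurable_preimage mg mA)).
Qed.

Lemma same_law_ext d1 d2 d' (T1 : measurableType d1) (T2 : measurableType d2)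
    (S : measurableType d') (P1 : probability T1 R) (X1 Y1 : T1 -> S)
    (P2 : probability T2 R) (X2 Y2 : T2 -> S) :
  X1 =1 Y1 -> X2 =1 Y2 -> same_law P1 X1 P2 X2 -> same_law P1 Y1 P2 Y2.
Proof. by move=> /funext-> /funext->. Qed.

(** Product measures are determined by their values on rectangles, and the
    law of a pair of independent variables by its two marginals. *)
Lemma same_law_pair d1 d2 d3 d4 d' d'' (T1 : measurableType d1)
    (T2 : measurableType d2) (T3 : measurableType d3)
    (T4 : measurableType d4) (S : measurableType d') (S' : measurableType d'')
    (P1 : probability T1 R) (X1 : T1 -> S)
    (Q1 : probability T2 R) (Y1 : T2 -> S)
    (P2 : probability T3 R) (X2 : T3 -> S')
    (Q2 : probability T4 R) (Y2 : T4 -> S') :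
  same_law P1 X1 Q1 Y1 -> same_law P2 X2 Q2 Y2 ->
  same_law (P1 \x P2)%E (fun w => (X1 w.1, X2 w.2))
    (Q1 \x Q2)%E (fun w => (Y1 w.1, Y2 w.2)).
Proof.
move=> [mX1 mY1 h1] [mX2 mY2 h2].
have mX : measurable_fun [set: T1 * T3] (fun w => (X1 w.1, X2 w.2)).
  by apply: measurable_fun_pair; apply: measurableT_comp.
have mY : measurable_fun [set: T2 * T4] (fun w => (Y1 w.1, Y2 w.2)).
  by apply: measurable_fun_pair; apply: measurableT_comp.
split => // A mA.
have := @product_measure_unique _ _ _ _ _ (image_law P1 mX1) (image_law P2 mX2)
    (image_law (P1 \x P2)%E mX).
have := @product_measure_unique _ _ _ _ _ (image_law P1 mX1) (image_law P2 mX2)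
    (image_law (Q1 \x Q2)%E mY).
move=> hY hX; transitivity ((image_law P1 mX1 \x image_law P2 mX2)%E A).
  apply/esym/hX => // B C mB mC.
  exact: (product_measure1E P1 P2 (measurable_preimage mX1 mB)
    (measurable_preimage mX2 mC)).
apply: hY => // B C mB mC.
apply: (etrans (product_measure1E Q1 Q2 (measurable_preimage mY1 mB)
  (measurable_preimage mY2 mC))).
exact: (congr2 mule (esym (h1 B mB)) (esym (h2 C mC))).
Qed.

(** Conditioning on the first component: the measure of an event under [P1
    \x P2] is the [P1]-integral of the measures of its sections, so laws
    that agree for every fixed value of that component agree. *)
Lemma same_law_cond d1 d2 d3 d' (T1 : measurableType d1)
    (T2 : measurableType d2) (T3 : measurableType d3) (S : measurableType d')
    (P1 : probability T1 R) (P2 : probability T2 R) (P3 : probability T3 R)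
    (F : T1 * T2 -> S) (G : T1 * T3 -> S) :
  measurable_fun [set: T1 * T2] F -> measurable_fun [set: T1 * T3] G ->
  (forall x, same_law P2 (fun y => F (x, y)) P3 (fun y => G (x, y))) ->
  same_law (P1 \x P2)%E F (P1 \x P3)%E G.
Proof.
move=> mF mG h; split => // A mA; rewrite /pushforward /product_measure1.
apply: eq_integral => x _ /=; have [_ _ /(_ A mA)] := h x.
rewrite /pushforward => e.
transitivity (P2 ((fun y => F (x, y)) @^-1` A)).
  by congr (P2 _); apply/seteqP; split => y; rewrite /xsection/= ?inE.
by rewrite e; congr (P3 _); apply/seteqP; split => y; rewrite /xsection/= ?inE.
Qed.

Lemma same_law_fst d1 d2 (T1 : measurableType d1) (T2 : measurableType d2)
    (P1 : probability T1 R) (P2 : probability T2 R) :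
  same_law (P1 \x P2)%E fst P1 id.
Proof.
split => // A mA; rewrite /pushforward preimage_id -[RHS]mule1.
rewrite -(probability_setT P2) -product_measure1E//; congr (_ _).
by apply/seteqP; split => x //= [].
Qed.

Lemma same_law_snd d1 d2 (T1 : measurableType d1) (T2 : measurableType d2)
    (P1 : probability T1 R) (P2 : probability T2 R) :
  same_law (P1 \x P2)%E snd P2 id.
Proof.
split => // A mA; rewrite /pushforward preimage_id -[RHS]mul1e.
rewrite -(probability_setT P1) -product_measure1E//; congr (_ _).
by apply/seteqP; split => x //= [].
Qed.

Lemma same_law_integral d1 d2 d' (T1 : measurableType d1)
    (T2 : measurableType d2) (S : measurableType d')
    (P1 : probability T1 R) (X1 : T1 -> S)
    (P2 : probability T2 R) (X2 : T2 -> S) (f : S -> \bar R) :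
  measurable_fun [set: S] f -> (forall x, 0 <= f x)%E ->
  same_law P1 X1 P2 X2 ->
  (\int[P1]_x f (X1 x) = \int[P2]_x f (X2 x))%E.
Proof.
move=> mf f0 [m1 m2 h].
have e1 := @ge0_integral_pushforward _ _ _ _ _ _ m1 P1 setT f measurableT mf
  (fun x _ => f0 x).
have e2 := @ge0_integral_pushforward _ _ _ _ _ _ m2 P2 setT f measurableT mf
  (fun x _ => f0 x).
move: e1 e2; rewrite !preimage_setT => <- <-.
by apply: eq_measure_integral => A mA _; exact: h.
Qed.

End laws.

(** * Measurability and product laws of matrices *)

Section measurable_matrix_operations.
Context {R : realType} d (T : measurableType d).

Lemma measurable_mulmx m n p (f : T -> 'M[R]_(m, n)) (g : T -> 'M[R]_(n, p)) :
  measurable_fun [set: T] f -> measurable_fun [set: T] g ->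
  measurable_fun [set: T] (fun x => f x *m g x).
Proof.
move=> /measurable_fun_mxP mf /measurable_fun_mxP mg.
apply/measurable_fun_mxP => i j; under eq_fun do rewrite mxE.
by apply: measurable_sum => k; apply: measurable_funM.
Qed.

Lemma measurable_trmx m n (f : T -> 'M[R]_(m, n)) :
  measurable_fun [set: T] f -> measurable_fun [set: T] (fun x => (f x)^T).
Proof.
move=> /measurable_fun_mxP mf; apply/measurable_fun_mxP => i j.
by under eq_fun do rewrite mxE; exact: mf.
Qed.

Lemma measurable_col_mx m1 m2 n (f : T -> 'M[R]_(m1, n))
    (g : T -> 'M[R]_(m2, n)) :
  measurable_fun [set: T] f -> measurable_fun [set: T] g ->
  measurable_fun [set: T] (fun x => col_mx (f x) (g x)).
Proof.
move=> /measurable_fun_mxP mf /measurable_fun_mxP mg.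
apply/measurable_fun_mxP => i j; under eq_fun do rewrite mxE.
by case: (fintype.split _) => k; [exact: mf|exact: mg].
Qed.

Lemma measurable_row_mx m n1 n2 (f : T -> 'M[R]_(m, n1))
    (g : T -> 'M[R]_(m, n2)) :
  measurable_fun [set: T] f -> measurable_fun [set: T] g ->
  measurable_fun [set: T] (fun x => row_mx (f x) (g x)).
Proof.
move=> /measurable_fun_mxP mf /measurable_fun_mxP mg.
apply/measurable_fun_mxP => i j; under eq_fun do rewrite mxE.
by case: (fintype.split _) => k; [exact: mf|exact: mg].
Qed.

Lemma measurable_mxsub m n p q (h : 'I_p -> 'I_m) (k : 'I_q -> 'I_n)
    (f : T -> 'M[R]_(m, n)) :
  measurable_fun [set: T] f ->
  measurable_fun [set: T] (fun x => mxsub h k (f x)).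
Proof.
move=> /measurable_fun_mxP mf; apply/measurable_fun_mxP => i j.
by under eq_fun do rewrite mxE; exact: mf.
Qed.

Lemma measurable_det n (f : T -> 'M[R]_n) :
  measurable_fun [set: T] f -> measurable_fun [set: T] (fun x => \det (f x)).
Proof.
move=> /measurable_fun_mxP mf; apply: measurable_sum => s.
by apply: measurable_funM => //; apply: measurable_prod => i _.
Qed.

Lemma measurable_scalar_mx n (f : T -> R) :
  measurable_fun [set: T] f ->
  measurable_fun [set: T] (fun x => (f x)%:M : 'M[R]_n).
Proof.
move=> mf; apply/measurable_fun_mxP => i j; under eq_fun do rewrite mxE.
by case: (i == j); [exact: mf|exact: measurable_cst].
Qed.

End measurable_matrix_operations.

Section product_matrix_law.
Context {R : realType}.

(** The pi-system on which laws of random matrices are compared. *)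
Definition mx_box m n (A : 'I_m -> 'I_n -> set R) : set 'M[R]_(m, n) :=
  [set M | forall i j, A i j (M i j)].

Lemma measurable_mx_box m n (A : 'I_m -> 'I_n -> set R) :
  (forall i j, measurable (A i j)) -> measurable (mx_box A).
Proof.
move=> mA; have -> : mx_box A = \big[setI/setT]_(i < m) \big[setI/setT]_(j < n)
    ((fun M : 'M[R]_(m, n) => M i j) @^-1` A i j).
  rewrite -bigcap_seq; under eq_bigcapr do rewrite -bigcap_seq.
  apply/seteqP; split => [M hM i _ j _|M hM i j]; first exact: hM.
  by apply: hM => //=; rewrite mem_index_enum.
apply: bigsetI_measurable => i _; apply: bigsetI_measurable => j _.
exact: measurable_preimage (measurable_mx_entry i j) (mA i j).
Qed.

(** The entries are independent, with entry [(i, j)] of law [mu i j]. *)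
Definition product_mx_law m n (mu : 'I_m -> 'I_n -> set R -> \bar R)
    (P : set 'M[R]_(m, n) -> \bar R) :=
  forall A : 'I_m -> 'I_n -> set R, (forall i j, measurable (A i j)) ->
    P (mx_box A) = (\prod_(i < m) \prod_(j < n) mu i j (A i j))%E.

(** Boxes are stable under intersection and generate the sigma-algebra of
    matrices, cylinders being boxes with all sides but one equal to [setT]. *)
Lemma product_mx_law_unique m n (mu : 'I_m -> 'I_n -> set R -> \bar R)
    (P Q : probability 'M[R]_(m, n) R) :
  product_mx_law mu P -> product_mx_law mu Q ->
  same_law P id Q id.
Proof.
move=> hP hQ; split => // B mB; rewrite /pushforward preimage_id.
pose G := [set mx_box A | A in [set A : 'I_m -> 'I_n -> set R |
   forall i j, measurable (A i j)]].
apply: (measure_unique G (fun=> setT)) => //.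
- apply/seteqP; split.
    apply: sub_sigma_algebra2 => _ [i [j [A mA ->]]].
    exists (fun i' j' => if (i' == i) && (j' == j) then A else setT).
      by move=> i' j'; case: ifP.
    apply/seteqP; split => M /=.
      by move/(_ i j); rewrite !eqxx.
    by move=> hM i' j'; case: ifP => // /andP[/eqP-> /eqP->].
  apply: smallest_sub; first exact: sigma_algebra_measurable.
  by move=> _ [A mA <-]; exact: measurable_mx_box.
- move=> _ _ [A mA <-] [A' mA' <-]; exists (fun i j => A i j `&` A' i j).
    by move=> i j; exact: measurableI.
  apply/seteqP; split => M /=.
    by move=> h; split => i j; case: (h i j).
  by move=> [h h'] i j; split; [exact: h|exact: h'].
- by move=> _; exists (fun _ _ => setT) => //; apply/seteqP; split.
- by rewrite bigcup_const.
- by move=> _ [A mA <-]; apply: (etrans (hP A mA)); exact: (esym (hQ A mA)).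
- by move=> _; apply: (le_lt_trans (probability_le1 P _)); rewrite ?ltry.
Qed.

Lemma product_mx_law_col m1 m2 n (mu1 : 'I_m1 -> 'I_n -> set R -> \bar R)
    (mu2 : 'I_m2 -> 'I_n -> set R -> \bar R)
    (P1 : probability 'M[R]_(m1, n) R) (P2 : probability 'M[R]_(m2, n) R) :
  product_mx_law mu1 P1 -> product_mx_law mu2 P2 ->
  product_mx_law (fun i j => match fintype.split i with
    inl i1 => mu1 i1 j | inr i2 => mu2 i2 j end)
    (pushforward (P1 \x P2)%E (fun w => col_mx w.1 w.2)).
Proof.
move=> h1 h2 A mA; rewrite /pushforward.
have -> : (fun w : 'M[R]_(m1, n) * 'M[R]_(m2, n) =>
  col_mx w.1 w.2) @^-1` mx_box A =
   mx_box (fun i j => A (lshift m2 i) j) `*` mx_box (fun i j =>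
     A (rshift m1 i) j).
  apply/seteqP; split => -[M1 M2] /= h.
    split=> i j /=; first by have := h (lshift _ i) j; rewrite col_mxEu.
    by have := h (rshift _ i) j; rewrite col_mxEd.
  move=> i j; rewrite mxE; case: splitP => k ik; have [h3 h4] := h.
    have -> : i = lshift m2 k by exact: val_inj.
    exact: h3.
  have -> : i = rshift m1 k by exact: val_inj.
  exact: h4.
apply: (etrans (product_measure1E P1 P2 (measurable_mx_box _)
  (measurable_mx_box _))); [exact: (fun i j => mA _ _)..|].
apply: (etrans (congr2 mule (h1 _ _) (h2 _ _)));
  [exact: (fun i j => mA _ _)..|].
rewrite big_split_ord/=; congr mule.
  by apply: eq_bigr => i _; apply: eq_bigr => j _;
    rewrite -[lshift _ _]/(unsplit (inl i)) unsplitK.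
by apply: eq_bigr => i _; apply: eq_bigr => j _;
  rewrite -[rshift _ _]/(unsplit (inr i)) unsplitK.
Qed.

Lemma product_mx_law_row m n1 n2 (mu1 : 'I_m -> 'I_n1 -> set R -> \bar R)
    (mu2 : 'I_m -> 'I_n2 -> set R -> \bar R)
    (P1 : probability 'M[R]_(m, n1) R) (P2 : probability 'M[R]_(m, n2) R) :
  product_mx_law mu1 P1 -> product_mx_law mu2 P2 ->
  product_mx_law (fun i j => match fintype.split j with
    inl j1 => mu1 i j1 | inr j2 => mu2 i j2 end)
    (pushforward (P1 \x P2)%E (fun w => row_mx w.1 w.2)).
Proof.
move=> h1 h2 A mA; rewrite /pushforward.
have -> : (fun w : 'M[R]_(m, n1) * 'M[R]_(m, n2) =>
  row_mx w.1 w.2) @^-1` mx_box A =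
   mx_box (fun i j => A i (lshift n2 j)) `*` mx_box (fun i j =>
     A i (rshift n1 j)).
  apply/seteqP; split => -[M1 M2] /= h.
    split=> i j /=; first by have := h i (lshift _ j); rewrite row_mxEl.
    by have := h i (rshift _ j); rewrite row_mxEr.
  move=> i j; rewrite mxE; case: splitP => k ik; have [h3 h4] := h.
    have -> : j = lshift n2 k by exact: val_inj.
    exact: h3.
  have -> : j = rshift n1 k by exact: val_inj.
  exact: h4.
apply: (etrans (product_measure1E P1 P2 (measurable_mx_box _)
  (measurable_mx_box _))); [exact: (fun i j => mA _ _)..|].
apply: (etrans (congr2 mule (h1 _ _) (h2 _ _)));
  [exact: (fun i j => mA _ _)..|].
rewrite -big_split; apply: eq_bigr => i _ /=; rewrite big_split_ord/=.
congr mule.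
  by apply: eq_bigr => j _; rewrite -[lshift _ _]/(unsplit (inl j)) unsplitK.
by apply: eq_bigr => j _; rewrite -[rshift _ _]/(unsplit (inr j)) unsplitK.
Qed.

End product_matrix_law.

(** * Gaussian matrices *)

Section product_mx.
Context {R : realType}.

Lemma product_mx_law_ext m n (mu nu : 'I_m -> 'I_n -> set R -> \bar R)
    (P : set 'M[R]_(m, n) -> \bar R) :
  (forall i j, mu i j = nu i j) -> product_mx_law mu P -> product_mx_law nu P.
Proof.
move=> e h A mA; rewrite h//; apply: eq_bigr => i _; apply: eq_bigr => j _.
by rewrite e.
Qed.

(** A family on ['I_(n1 + n2)] is recovered from its two halves; this is how
    entry laws of a block matrix are matched with those of its blocks. *)
Lemma case_split_shift n1 n2 (S : Type) (f : 'I_(n1 + n2) -> S) j :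
  match fintype.split j with
  | inl j1 => f (lshift n2 j1) | inr j2 => f (rshift n1 j2) end = f j.
Proof. by case: splitP => k e; congr f; exact: val_inj. Qed.

(** A row is built entry by entry from iterated product measures. *)
Lemma product_mx_law_exists_row n (mu : 'I_1 -> 'I_n -> probability R R) :
  exists P : probability 'M[R]_(1, n) R, product_mx_law (fun i j => mu i j) P.
Proof.
elim: n => [|n IHn] in mu *.
  exists (dirac (0 : 'M[R]_(1, 0))) => A mA.
  rewrite big1 => [|i _]; last by rewrite big_ord0.
  rewrite (_ : mx_box A = setT) ?probability_setT//.
  by apply/seteqP; split => // M _ i [].
have [P2 hP2] := IHn (fun i j => mu i (rshift 1 j)).
have m1 : measurable_fun [set: R] (fun x : R => x%:M : 'M[R]_1).
  exact: measurable_scalar_mx.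
have hP1 : product_mx_law (fun i (j : 'I_1) => mu i (lshift n j))
    (image_law (mu ord0 (lshift n (ord0 : 'I_1))) m1).
  move=> A mA; rewrite !big_ord1; congr (mu _ _ _).
  apply/seteqP; split => x /=; first by move/(_ 0 0); rewrite mxE.
  by move=> h i j; rewrite !ord1 mxE.
have mr : measurable_fun [set: 'M[R]_1 * 'M[R]_(1, n)]
    (fun w => row_mx w.1 w.2) by exact: measurable_row_mx.
exists (image_law (image_law (mu ord0 (lshift n (ord0 : 'I_1))) m1 \x P2)%E mr).
apply: product_mx_law_ext (product_mx_law_row hP1 hP2) => i j.
exact: (@case_split_shift 1 n _ (fun j => mu i j : set R -> \bar R)).
Qed.

Lemma product_mx_law_exists m n (mu : 'I_m -> 'I_n -> probability R R) :
  exists P : probability 'M[R]_(m, n) R, product_mx_law (fun i j => mu i j) P.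
Proof.
elim: m => [|m IHm] in mu *.
  exists (dirac (0 : 'M[R]_(0, n))) => A mA; rewrite big_ord0.
  rewrite (_ : mx_box A = setT) ?probability_setT//.
  by apply/seteqP; split => // M _ [].
have [P2 hP2] := IHm (fun i => mu (rshift 1 i)).
have [P1 hP1] : exists P : probability 'M[R]_(1, n) R,
    product_mx_law (fun (i : 'I_1) j => mu (lshift m i) j) P.
  exact: product_mx_law_exists_row (fun i : 'I_1 => mu (lshift m i)).
have mc : measurable_fun [set: 'M[R]_(1, n) * 'M[R]_(m, n)]
    (fun w => col_mx w.1 w.2) by exact: measurable_col_mx.
exists (image_law (P1 \x P2)%E mc).
apply: product_mx_law_ext (product_mx_law_col hP1 hP2) => i j.
exact: (@case_split_shift 1 m _ (fun i => mu i j : set R -> \bar R)).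
Qed.

Definition product_mx m n (mu : 'I_m -> 'I_n -> probability R R) :
  probability 'M[R]_(m, n) R := sval (cid (product_mx_law_exists mu)).

Lemma product_mxP m n (mu : 'I_m -> 'I_n -> probability R R) :
  product_mx_law (fun i j => mu i j) (product_mx mu).
Proof. exact: svalP (cid (product_mx_law_exists mu)). Qed.

(** The characterization used to identify laws of random matrices: it is
    enough to compute the probabilities of boxes. *)
Lemma product_mx_unique m n (mu : 'I_m -> 'I_n -> probability R R)
    d (T : measurableType d) (P : probability T R) (X : T -> 'M[R]_(m, n)) :
  measurable_fun [set: T] X ->
  product_mx_law (fun i j => mu i j) (pushforward P X) ->
  same_law P X (product_mx mu) id.
Proof.
move=> mX hX; apply: same_law_trans (same_law_image P mX) _.
exact: (@product_mx_law_unique _ _ _ _ (image_law P mX) _ hX (product_mxP mu)).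
Qed.

Lemma product_mx_col m1 m2 n (mu : 'I_(m1 + m2) -> 'I_n -> probability R R) :
  same_law (product_mx (fun i j => mu (lshift m2 i) j) \x
            product_mx (fun i j => mu (rshift m1 i) j))%E
    (fun w => col_mx w.1 w.2) (product_mx mu) id.
Proof.
apply: product_mx_unique; first exact: measurable_col_mx.
apply: product_mx_law_ext (product_mx_law_col (product_mxP _) (product_mxP _)).
move=> i j; exact: (case_split_shift (fun i => mu i j : set R -> \bar R)).
Qed.

Lemma product_mx_row m n1 n2 (mu : 'I_m -> 'I_(n1 + n2) -> probability R R) :
  same_law (product_mx (fun i j => mu i (lshift n2 j)) \x
            product_mx (fun i j => mu i (rshift n1 j)))%E
    (fun w => row_mx w.1 w.2) (product_mx mu) id.
Proof.
apply: product_mx_unique; first exact: measurable_row_mx.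
apply: product_mx_law_ext (product_mx_law_row (product_mxP _) (product_mxP _)).
move=> i j; exact: (case_split_shift (fun j => mu i j : set R -> \bar R)).
Qed.

Lemma product_mx_scalar (mu : probability R R) :
  same_law mu (fun x => x%:M) (product_mx (fun _ _ : 'I_1 => mu)) id.
Proof.
apply: product_mx_unique; first exact: measurable_scalar_mx.
move=> A mA; rewrite !big_ord1; congr (mu _).
apply/seteqP; split => x /=; first by move/(_ 0 0); rewrite mxE.
by move=> h i j; rewrite !ord1 mxE.
Qed.

(** An independent family, possibly indexed by another type and larger than
    the matrix, fills the matrix through an injection [e] of the positions
    into the indices. *)
Lemma same_law_independent (I : finType) m n (e : 'I_m -> 'I_n -> I)
    d (T : measurableType d) (P : probability T R) (X : I -> T -> R)
    (mu : 'I_m -> 'I_n -> probability R R) :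
  injective (fun ij : 'I_m * 'I_n => e ij.1 ij.2) ->
  mutually_independent P X ->
  (forall i j, has_law P (X (e i j)) (mu i j)) ->
  same_law P (fun w => \matrix_(i, j) X (e i j) w) (product_mx mu) id.
Proof.
move=> e_inj indX hX; apply: product_mx_unique.
  apply/measurable_fun_mxP => i j; under eq_fun do rewrite mxE.
  by case: (hX i j).
move=> A mA.
(* Independence is applied to the image of [e]; [B] transports the box along
   [e], with the default [setT] off the image. *)
pose B k := if [pick ij : 'I_m * 'I_n | e ij.1 ij.2 == k] is Some ij
  then A ij.1 ij.2 else setT.
have Be i j : B (e i j) = A i j.
  rewrite /B; case: pickP => [ij /eqP h|/(_ (i, j))]; last by rewrite eqxx.
  by have /= -> := e_inj ij (i, j) h.
have mB k : measurable (B k) by rewrite /B; case: pickP.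
pose K := [set e ij.1 ij.2 | ij : 'I_m * 'I_n]%SET.
have := indX K B mB.
rewrite big_imset/=; last by move=> x y _ _; exact: e_inj.
rewrite (eq_bigl xpredT); last by move=> ij; rewrite inE.
rewrite -(pair_bigA _ (fun i j => P (X (e i j) @^-1` B (e i j))))/=.
move=> h; transitivity (\prod_(i < m) \prod_(j < n) P (X (e i j)
  @^-1` B (e i j)))%E.
  rewrite -h /pushforward; congr (P _); apply/seteqP; split => w /=.
    move=> hw k /= /imsetP[[i j] _ ->] /=; rewrite Be.
    by have := hw i j; rewrite mxE.
  move=> hw i j; rewrite mxE -Be; apply: hw => /=.
  by apply/imsetP; exists (i, j).
apply: eq_bigr => i _; apply: eq_bigr => j _; rewrite Be.
by have [_ /(_ _ (mA i j))] := hX i j.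
Qed.

(** [normal_prob] lives on the type of reals with the sigma-algebra
    generated by intervals; [normal_law] is the same measure on the reals
    themselves. *)
Definition normal_law : probability R R :=
  @image_law R _ _ (measurableTypeR R) R (normal_prob 0 1) idfun
    (@measurable_id _ _ _).

Definition gaussian m n : probability 'M[R]_(m, n) R :=
  product_mx (fun _ _ => normal_law).

Lemma gaussianP m n : product_mx_law (fun _ _ => normal_law) (gaussian m n).
Proof. exact: product_mxP. Qed.

Lemma gaussian_col m1 m2 n :
  same_law (gaussian m1 n \x gaussian m2 n)%E (fun w => col_mx w.1 w.2)
    (gaussian (m1 + m2) n) id.
Proof. exact: (product_mx_col (fun _ _ => normal_law)). Qed.

Lemma gaussian_row m n1 n2 :
  same_law (gaussian m n1 \x gaussian m n2)%E (fun w => row_mx w.1 w.2)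
    (gaussian m (n1 + n2)) id.
Proof. exact: (product_mx_row (fun _ _ => normal_law)). Qed.

Lemma gaussian_scalar :
  same_law normal_law (fun x => x%:M) (gaussian 1 1) id.
Proof. exact: product_mx_scalar. Qed.

(** The omitted rows contribute factors [1] to the probability of a box. *)
Lemma gaussian_rowsub m n p (f : 'I_p -> 'I_m) : injective f ->
  same_law (gaussian m n) (rowsub f) (gaussian p n) id.
Proof.
move=> f_inj; apply: product_mx_unique; first exact: measurable_mxsub.
move=> A mA.
(* The event is a box whose sides are [setT] in the rows that are left out. *)
pose B (i : 'I_m) j := if [pick k | f k == i] is Some k then A k j else setT.
have Bf k : B (f k) = A k.
  apply/funext => j; rewrite /B; case: pickP => [l /eqP/f_inj-> //|/(_ k)].
  by rewrite eqxx.
have mB i j : measurable (B i j) by rewrite /B; case: pickP.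
have h := gaussianP mB.
transitivity (gaussian m n (mx_box B)).
  rewrite /pushforward; congr (gaussian m n _); apply/seteqP;
    split => M /= hM i j.
    rewrite /B; case: pickP => // k /eqP <-.
    by have := hM k j; rewrite mxE.
  by rewrite mxE -Bf.
apply: (etrans h); rewrite (bigID (fun i => i \in [set f k | k : 'I_p]%SET))/=.
rewrite big_imset/=; last by move=> x y _ _; exact: f_inj.
rewrite [X in (_ * X)%E]big1 ?mule1.
  rewrite (eq_bigl xpredT); last by move=> k; rewrite inE.
  by apply: eq_bigr => k _; apply: eq_bigr => j _; rewrite Bf.
move=> i iNf; apply: big1 => j _; rewrite /B; case: pickP => [k /eqP e|_].
  by move/imsetP: iNf; case; exists k.
exact: probability_setT.
Qed.

(** Independence of the columns and, inside each column, of the entries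
    makes the probability of a box a double product. *)
Lemma gaussian_columns d (T : measurableType d) (P : probability T R) m n
    (X : T -> 'M[R]_(m, n)) : measurable_fun [set: T] X ->
  mutually_independent P (fun (j : 'I_n) w => col j (X w)) ->
  (forall j : 'I_n, std_normal_vector P (fun w => col j (X w))) ->
  same_law P X (gaussian m n) id.
Proof.
move=> mX indX hX; apply: product_mx_unique => // A mA.
rewrite exchange_big/=.
have e j : (\prod_(i < m) normal_law (A i j) =
    P ((fun w => col j (X w)) @^-1` mx_box (fun i _ => A i j)))%E.
  have [ind nor] := hX j.
  have := ind [set: 'I_m]%SET (A^~ j) (fun i => mA i j).
  rewrite (eq_bigl xpredT); last by move=> i; rewrite inE.
  move=> h; transitivity (\prod_(i < m) P ((fun w =>
    col j (X w) i ord0) @^-1` A i j))%E.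
    by apply: eq_bigr => i _; have [_ /(_ _ (mA i j))] := nor i.
  rewrite -h; congr (P _); apply/seteqP; split => w /=.
    by move=> hw i k; rewrite ord1; apply: hw; rewrite /= inE.
  by move=> hw i _; apply: hw.
rewrite (eq_bigr _ (fun j _ => e j)).
have h := indX [set: 'I_n]%SET (fun j => mx_box (fun i _ => A i j))
  (fun j => measurable_mx_box (fun i _ => mA i j)).
rewrite [RHS](eq_bigl (fun j => j \in [set: 'I_n]%SET)); last first.
  by move=> j; rewrite finset.in_setT.
rewrite -h; rewrite /pushforward; congr (P _); apply/seteqP; split => w /=.
  by move=> hw j _ i k; rewrite mxE.
by move=> hw i j; have := hw j; rewrite /= inE => /(_ isT i 0); rewrite mxE.
Qed.

End product_mx.

(** * Densities and translations *)

Section density.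
Local Open Scope ereal_scope.
Import HBNNSimple.
Context d (T : measurableType d) {R : realType}.
Context (mu nu : {measure set T -> \bar R}) (g : T -> R)
  (mg : measurable_fun [set: T] g) (g0 : forall x, (0 <= g x)%R)
  (nuE : forall A, measurable A -> nu A = \int[mu]_(x in A) (g x)%:E).

(** Both sides are linear in the values of the simple function, and on an
    indicator the equality is the definition of the density. *)
Let nnsfun_density (f : {nnsfun T >-> R}) :
  \int[nu]_x (f x)%:E = \int[mu]_x ((f x)%:E * (g x)%:E).
Proof.
under eq_integral do rewrite fimfunE -fsumEFin//.
rewrite ge0_integral_fsum//; last 2 first.
- by move=> r; exact/measurable_EFinP/measurable_funM.
- by move=> r x _; rewrite nnfun_muleindic_ge0.
under [RHS]eq_integral => x _.
  rewrite fimfunE -fsumEFin// ge0_mule_fsuml; last first.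
    by move=> r; rewrite nnfun_muleindic_ge0.
  over.
rewrite ge0_integral_fsum//; last 2 first.
- move=> r; apply/measurable_EFinP => //=.
  by apply: measurable_funM => //; exact: measurable_funM.
- by move=> r x _; rewrite mule_ge0 ?nnfun_muleindic_ge0 ?lee_fin.
apply: eq_fsbigr => r _; rewrite integralZl_indic_nnsfun// integral_indic//=
  setIT.
rewrite nuE//.
have [r0|r0] := ltP r 0%R.
  rewrite preimage_nnfun0// integral_set0 mule0 integral0_eq// => x _.
  by rewrite indic0 mulr0 mul0e.
under [RHS]eq_integral do rewrite EFinM -muleA.
rewrite ge0_integralZl//; last 2 first.
- by apply/measurable_EFinP; apply: measurable_funM.
- by move=> x _; rewrite lee_fin mulr_ge0.
by rewrite integral_mkcond; congr (_ * _); apply: eq_integral => x _;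
  rewrite patchE indicE; case: ifP => _; rewrite ?mul1e ?mul0e.
Qed.

(** Monotone convergence from simple functions. *)
Lemma ge0_integral_density (f : T -> \bar R) :
  measurable_fun [set: T] f -> (forall x, 0 <= f x) ->
  \int[nu]_x f x = \int[mu]_x (f x * (g x)%:E).
Proof.
move=> mf f0; pose f_ := nnsfun_approx measurableT mf.
transitivity (limn (fun n => \int[nu]_x (f_ n x)%:E)).
  rewrite -monotone_convergence//.
  - apply: eq_integral => y _; apply/esym/cvg_lim => //.
    by apply: cvg_nnsfun_approx=> // *; apply: f0; rewrite inE.
  - by move=> n; exact/measurable_EFinP/measurable_funP.
  - by move=> n y _; rewrite lee_fin.
  - by move=> y _ m n mn; rewrite lee_fin; exact/lefP/nd_nnsfun_approx.
under eq_fun do rewrite nnsfun_density.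
rewrite -monotone_convergence//.
- apply: eq_integral => y _; apply/cvg_lim => //.
  apply: cvgeMr => //.
  by apply: cvg_nnsfun_approx=> // *; apply: f0; rewrite inE.
- by move=> n; apply: emeasurable_funM; exact/measurable_EFinP.
- by move=> n y _; rewrite mule_ge0// lee_fin.
- move=> y _ m n mn; rewrite lee_wpmul2r ?lee_fin//.
  exact/lefP/nd_nnsfun_approx.
Qed.

End density.

Section translation.
Local Open Scope ereal_scope.
Context {R : realType}.
Local Notation mu := (@lebesgue_measure R).
Local Notation TR := (measurableTypeR R).

(** Lebesgue measure is determined by the lengths of intervals. *)
Lemma lebesgue_measure_shift (a : R) (A : set R) : measurable A ->
  pushforward mu ((fun x => x + a)%R : TR -> TR) A = mu A.
Proof.
move=> mA.
have ms : measurable_fun [set: TR] ((fun x => x + a)%R : TR -> TR).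
  exact: measurable_funD.
apply/esym/lebesgue_measure_unique => //= _ [[x y]] _ <-.
rewrite /pushforward (_ : _ @^-1` _ = `](x - a)%R, (y - a)%R]%classic).
  rewrite !lebesgue_measure_itv/= !lte_fin ltrD2r.
  by rewrite -!EFinB opprB addrA subrK.
by apply/seteqP; split => z /=; rewrite !in_itv/= ltrBlDr lerBrDr.
Qed.

Lemma ge0_integral_shift (a : R) (f : R -> \bar R) :
  measurable_fun [set: R] f -> (forall x, 0 <= f x) ->
  \int[mu]_x f (x + a)%R = \int[mu]_x f x.
Proof.
move=> mf f0.
have ms : measurable_fun [set: TR] ((fun x => x + a)%R : TR -> TR).
  exact: measurable_funD.
have := @ge0_integral_pushforward _ _ TR TR _ _ ms mu setT f measurableT mf
  (fun x _ => f0 x).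
rewrite preimage_setT => <-.
by apply: eq_measure_integral => A mA _; exact: lebesgue_measure_shift.
Qed.
End translation.

(** * Rotation invariance of the planar normal law *)

Section planar_rotation.
Local Open Scope ereal_scope.
Context {R : realType}.
Local Notation mu := (@lebesgue_measure R).
Local Notation TR := (measurableTypeR R).

Lemma ge0_integral_normal (f : R -> \bar R) :
  measurable_fun [set: R] f -> (forall x, 0 <= f x) ->
  \int[normal_prob (0:R) 1]_x f x = \int[mu]_x (f x * (normal_pdf 0 1 x)%:E).
Proof.
move=> mf f0.
apply: (@ge0_integral_density _ TR R mu (normal_prob (0:R) 1) (normal_pdf 0 1))
  => //.
  exact: measurable_normal_pdf.
exact: normal_pdf_ge0.
Qed.

Let J (f : TR * TR -> \bar R) := \int[mu]_x \int[mu]_y f (x, y).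

(** For fixed [x], this shear is a translation of [y]. *)
Let J_sheary (b : R) (f : TR * TR -> \bar R) :
  measurable_fun [set: TR * TR] f -> (forall x, 0 <= f x) ->
  J (fun w => f (w.1, (w.2 + b * w.1)%R : TR)) = J f.
Proof.
move=> mf f0; apply: eq_integral => x _.
by apply: (ge0_integral_shift (b * x) (f := fun y => f (x, y))) => //;
  apply: measurableT_comp.
Qed.

Let J_swap (f : TR * TR -> \bar R) :
  measurable_fun [set: TR * TR] f -> (forall x, 0 <= f x) ->
  J f = \int[mu]_y \int[mu]_x f (x, y).
Proof. by move=> mf f0; rewrite /J fubini_tonelli. Qed.

Let J_shearx (a : R) (f : TR * TR -> \bar R) :
  measurable_fun [set: TR * TR] f -> (forall x, 0 <= f x) ->
  J (fun w => f ((w.1 + a * w.2)%R : TR, w.2)) = J f.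
Proof.
move=> mf f0; rewrite !J_swap//.
  apply: eq_integral => y _.
  by apply: (ge0_integral_shift (a * y) (f := fun x => f (x, y))) => //;
    apply: measurableT_comp.
apply: measurableT_comp => //; apply: measurable_fun_pair => //=.
by apply: measurable_funD => //; exact: measurable_funM.
Qed.

(** A rotation with nonzero sine [s] is the product of a horizontal shear of
    ratio [a = (c - 1) / s], a vertical shear of ratio [s], and the first
    shear again. *)
Let J_rotation (c s : R) (f : TR * TR -> \bar R) :
  (c ^+ 2 + s ^+ 2 = 1)%R -> (s != 0)%R ->
  measurable_fun [set: TR * TR] f -> (forall x, 0 <= f x) ->
  J (fun w => f ((c * w.1 - s * w.2)%R : TR, (s * w.1 + c * w.2)%R : TR)) = J f.
Proof.
move=> cs s0 mf f0; pose a := ((c - 1) / s)%R.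
have ms1 (g : TR * TR -> \bar R) (b : R) : measurable_fun setT g ->
    measurable_fun setT (fun w : TR * TR => g ((w.1 + b * w.2)%R : TR, w.2)).
  move=> mg; apply: measurableT_comp => //; apply: measurable_fun_pair => //=.
  by apply: measurable_funD => //; exact: measurable_funM.
have ms2 (g : TR * TR -> \bar R) (b : R) : measurable_fun setT g ->
    measurable_fun setT (fun w : TR * TR => g (w.1, (w.2 + b * w.1)%R : TR)).
  move=> mg; apply: measurableT_comp => //; apply: measurable_fun_pair => //=.
  by apply: measurable_funD => //; exact: measurable_funM.
rewrite -(J_shearx a mf f0) -(J_sheary s (ms1 _ _ mf))//.
rewrite -(J_shearx a (ms2 _ _ (ms1 _ _ mf)))//.
(* [a * s = c - 1] and [c ^+ 2 + s ^+ 2 = 1] give [a * (2 + a * s) = - s]. *)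
have as_ : (a * s = c - 1)%R by rewrite /a divfK.
apply: eq_integral => x _; apply: eq_integral => y _ /=.
congr (f (_, _)).
  have -> : (x + a * y + a * (y + s * (x + a * y)) =
     (1 + a * s) * x + a * (2 + a * s) * y)%R by ring.
  have -> : (a * (2 + a * s) = - s)%R.
    rewrite as_; apply: (mulIf s0); rewrite mulrAC /a divfK//.
    have -> : (- s * s = c ^+ 2 - 1)%R by rewrite -cs; ring.
    by ring.
  by rewrite as_; ring.
have -> : (y + s * (x + a * y) = s * x + (1 + a * s) * y)%R by ring.
by rewrite as_; ring.
Qed.

Let density2 (w : TR * TR) : R := (normal_pdf 0 1 w.1 * normal_pdf 0 1 w.2)%R.

Let measurable_density2 : measurable_fun [set: TR * TR] density2.
Proof.
by apply: measurable_funM; apply: measurableT_comp => //;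
  exact: measurable_normal_pdf.
Qed.

Let density2_ge0 w : (0 <= density2 w)%R.
Proof. by rewrite mulr_ge0// normal_pdf_ge0. Qed.

Let normal2E (A : set (TR * TR)) : measurable A ->
  (normal_prob (0:R) 1 \x normal_prob (0:R) 1) A =
  J (fun w => (\1_A w * density2 w)%:E).
Proof.
move=> mA; pose f (w : TR * TR) := (\1_A w)%:E : \bar R.
have mf : measurable_fun [set: TR * TR] f.
  by apply/measurable_EFinP; exact: measurable_indic.
have f0 w : 0 <= f w by rewrite lee_fin.
have mfx x : measurable_fun [set: TR] (fun y => f (x, y)).
  by apply: measurableT_comp => //; exact: measurable_fun_pair.
transitivity (\int[normal_prob (0:R) 1 \x normal_prob (0:R) 1]_w f w).
  by rewrite integral_indic// setIT.
rewrite fubini_tonelli1// /fubini_F/=.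
rewrite (ge0_integral_normal (f := fun x => \int[normal_prob (0:R) 1]_y f (x,
  y))); first last.
- by move=> x; exact: integral_ge0.
- exact: (measurable_fun_fubini_tonelli_F (m2 := normal_prob (0:R) 1) f).
apply: eq_integral => x _.
rewrite (ge0_integral_normal (f := fun y => f (x, y)))//; last exact: mfx.
rewrite -ge0_integralZr//; last 3 first.
- apply: emeasurable_funM; first exact: mfx.
  by apply/measurable_EFinP; exact: measurable_normal_pdf.
- by move=> y _; rewrite mule_ge0// lee_fin normal_pdf_ge0.
- by rewrite lee_fin normal_pdf_ge0.
by apply: eq_integral => y _; rewrite -!EFinM /density2/=
  -mulrA [(_ y * _)%R]mulrC.
Qed.

(** The planar normal density depends only on [x ^+ 2 + y ^+ 2]. *)
Let density2_rotation (c s : R) w : (c ^+ 2 + s ^+ 2 = 1)%R ->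
  density2 ((c * w.1 - s * w.2)%R : TR, (s * w.1 + c * w.2)%R : TR) =
  density2 w.
Proof.
move=> cs; rewrite /density2 !normal_pdfE ?oner_eq0//= /normal_fun.
rewrite mulrACA -expRD [RHS]mulrACA -expRD; congr (_ * expR _)%R.
rewrite !subr0 -!mulrDl -!opprD; congr (- _ / _)%R.
transitivity ((c ^+ 2 + s ^+ 2) * (w.1 ^+ 2 + w.2 ^+ 2) : R)%R; first by ring.
by rewrite cs mul1r.
Qed.

Let normal_rotation_neq0 (c s : R) : (c ^+ 2 + s ^+ 2 = 1)%R -> (s != 0)%R ->
  same_law (normal_law \x normal_law : probability (R * R)%type R)
    (fun w => ((c * w.1 - s * w.2)%R, (s * w.1 + c * w.2)%R))
    (normal_law \x normal_law : probability (R * R)%type R)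
    (fun w => (w.1, w.2)).
Proof.
move=> cs s0.
have h : same_law (normal_prob 0 1 : probability TR R) (idfun : TR ->
  R) normal_law id.
  exact: same_law_image.
have hh := same_law_pair h h.
pose G (w : R * R) := ((c * w.1 - s * w.2)%R, (s * w.1 + c * w.2)%R).
have mG : measurable_fun [set: R * R] G.
  apply: measurable_fun_pair => /=.
    by apply: measurable_funB; exact: measurable_funM.
  by apply: measurable_funD; exact: measurable_funM.
have hG := same_law_comp mG hh.
have [me _ _] := hh.
have [mGe _ _] := hG.
apply: same_law_trans (same_law_sym hG) _; apply: same_law_trans hh.
split; [exact: mGe|exact: me|move=> A mA].
pose A' : set (TR * TR) := (fun w : TR * TR => (w.1, w.2) : R * R) @^-1` A.
have mA' : measurable A' by exact: measurable_preimage me mA.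
have mA'' := measurable_preimage mGe mA.
transitivity (J (fun w => (\1_A' w * density2 w)%:E)); last first.
  by apply/esym; apply: normal2E.
rewrite -(J_rotation cs s0)//; last 2 first.
- by apply/measurable_EFinP/measurable_funM => //; exact: measurable_indic.
- by move=> w; rewrite lee_fin mulr_ge0.
apply: (etrans (normal2E mA'')).
apply: eq_integral => x _; apply: eq_integral => y _.
by rewrite -[in LHS](density2_rotation _ cs).
Qed.

(** The rotation by pi has zero sine; it is the square of the quarter turn. *)
Lemma normal_rotation (c s : R) : (c ^+ 2 + s ^+ 2 = 1)%R ->
  same_law (normal_law \x normal_law : probability (R * R)%type R)
    (fun w => ((c * w.1 - s * w.2)%R, (s * w.1 + c * w.2)%R))
    (normal_law \x normal_law : probability (R * R)%type R)
    (fun w => (w.1, w.2)).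
Proof.
move=> cs; have [s0|] := eqVneq s 0%R; last exact: normal_rotation_neq0.
have [me _ _] := same_law_pair (same_law_refl normal_law (@measurable_id _ R
  setT))
   (same_law_refl normal_law (@measurable_id _ R setT)).
have h01 : (0 ^+ 2 + 1 ^+ 2 = 1 :> R)%R by rewrite expr0n expr1n add0r.
have h := normal_rotation_neq0 h01 (oner_neq0 _).
have [mh _ _] := h.
move: cs; rewrite s0 expr0n addr0 => /eqP; rewrite sqrf_eq1 => /orP[] /eqP ->.
  apply: same_law_ext (same_law_refl _ me) => w //.
  by rewrite !mul0r !mul1r subr0 add0r.
have h2 := same_law_comp mh h.
apply: same_law_trans h; apply: same_law_ext h2 => w //=.
by congr (_, _); ring.
Qed.


End planar_rotation.

(** * Matrices that preserve Gaussian laws *)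

Section invariance.
Context {R : realType}.

Lemma measurable_mulmxr m n p (Q : 'M[R]_(n, p)) :
  measurable_fun [set: 'M[R]_(m, n)] (mulmx^~ Q).
Proof. by apply: measurable_mulmx => //; exact: measurable_cst. Qed.

(** Quantifying over the number of rows [p] makes the notion stable under
    all the constructions below, and reduces it to [p = 1] because the rows
    of a Gaussian matrix are independent. *)
Definition gaussian_invariant n (Q : 'M[R]_n) :=
  forall p, same_law (gaussian p n) (mulmx^~ Q) (gaussian p n) id.

Lemma gaussian_invariant_row n (Q : 'M[R]_n) :
  same_law (gaussian 1 n) (mulmx^~ Q) (gaussian 1 n) id -> gaussian_invariant Q.
Proof.
move=> h; elim=> [|p IHp].
  apply: same_law_ext (same_law_refl (gaussian 0 n) (@measurable_id _ _ setT))
    => //.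
  by move=> X; rewrite [LHS]flatmx0 [RHS]flatmx0.
have hc := @gaussian_col R 1 p n.
have h1 := same_law_comp (measurable_mulmxr Q) (same_law_sym hc).
have mc : measurable_fun [set: 'M[R]_(1, n) * 'M[R]_(p, n)]
  (fun w => col_mx w.1 w.2) by exact: measurable_col_mx.
have h2 := same_law_comp mc (same_law_pair h IHp).
apply: same_law_trans h1 _.
apply: same_law_trans (same_law_trans h2 hc).
have [_ mh _] := same_law_sym h2.
apply: (same_law_ext (X1 := (fun w => col_mx w.1 w.2) \o (fun w => (w.1 *m Q,
  w.2 *m Q)))) (same_law_refl _ mh) => // w /=.
by rewrite mul_col_mx.
Qed.

Lemma gaussian_invariant1 n : gaussian_invariant (1%:M : 'M[R]_n).
Proof.
move=> p.
apply: same_law_ext (same_law_refl (gaussian p n) (@measurable_id _ _ setT)) =>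
  //.
by move=> X; rewrite mulmx1.
Qed.

Lemma gaussian_invariantM n (Q1 Q2 : 'M[R]_n) : gaussian_invariant Q1 ->
  gaussian_invariant Q2 -> gaussian_invariant (Q1 *m Q2).
Proof.
move=> h1 h2 p; have h := same_law_comp (measurable_mulmxr Q2) (h1 p).
apply: same_law_trans (h2 p).
by apply: same_law_ext h => // X /=; rewrite mulmxA.
Qed.

Lemma gaussian_invariant_block n1 n2 (Q1 : 'M[R]_n1) (Q2 : 'M[R]_n2) :
  gaussian_invariant Q1 -> gaussian_invariant Q2 ->
  gaussian_invariant (block_mx Q1 0 0 Q2).
Proof.
move=> h1 h2 p; have hr := @gaussian_row R p n1 n2.
have h := same_law_comp (measurable_mulmxr (block_mx Q1 0 0 Q2))
  (same_law_sym hr).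
apply: same_law_trans h _.
have mr : measurable_fun [set: 'M[R]_(p, n1) * 'M[R]_(p, n2)]
  (fun w => row_mx w.1 w.2) by exact: measurable_row_mx.
have h3 := same_law_comp mr (same_law_pair (h1 p) (h2 p)).
apply: same_law_trans (same_law_trans h3 hr).
have [_ mh _] := same_law_sym h3.
apply: same_law_ext (same_law_refl _ mh) => // w /=.
by rewrite mul_row_block !mulmx0 addr0 add0r.
Qed.

(** The symmetry of the normal law is read off the first coordinate of the
    planar rotation by pi. *)
Lemma gaussian_invariantN1 : gaussian_invariant (-1%:M : 'M[R]_1).
Proof.
apply: gaussian_invariant_row.
have h : ((-1) ^+ 2 + 0 ^+ 2 = 1 :> R) by rewrite sqrrN expr1n expr0n addr0.
have mf : measurable_fun [set: R * R] (fun w => w.1%:M : 'M[R]_1).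
  by apply: measurable_scalar_mx; exact: measurable_fst.
have h2 := same_law_comp mf (normal_rotation h).
have h3 := same_law_comp (@measurable_scalar_mx R _ _ 1 _ (@measurable_id _ _
  setT)) (same_law_fst (@normal_law R) (@normal_law R)).
have h4 := same_law_comp (measurable_mulmxr (-1%:M :
  'M[R]_1)) (same_law_sym (@gaussian_scalar R)).
apply: same_law_trans h4 _; apply: same_law_trans (gaussian_scalar (R := R)).
have h5 := same_law_comp (measurable_mulmxr (m := 1) (-1%:M : 'M[R]_1)) h3.
apply: same_law_trans (same_law_sym h5) _.
apply: same_law_trans h3.
apply: same_law_ext h2 => // w /=.
by rewrite mulmxN mulmx1 mul0r subr0 mulN1r raddfN.
Qed.

(** This is [normal_rotation] for the row [[x y]]. *)
Lemma gaussian_invariant_plane (c s : R) : c ^+ 2 + s ^+ 2 = 1 ->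
  gaussian_invariant (block_mx c%:M s%:M (- s)%:M c%:M : 'M[R]_(1 + 1)).
Proof.
move=> cs; apply: gaussian_invariant_row.
have h1 := same_law_pair (@gaussian_scalar R) (@gaussian_scalar R).
have mr : measurable_fun [set: 'M[R]_1 * 'M[R]_1] (fun w => row_mx w.1 w.2).
  exact: measurable_row_mx.
have h2 := same_law_trans (same_law_comp mr h1) (@gaussian_row R 1 1 1).
have mr2 : measurable_fun [set: R * R] (fun w => row_mx w.1%:M w.2%:M :
  'M[R]_(1, 1 + 1)).
  by apply: measurable_row_mx; apply: measurable_scalar_mx.
have h3 := same_law_comp mr2 (normal_rotation cs).
have h4 := same_law_comp (measurable_mulmxr (block_mx c%:M s%:M (- s)%:M c%:M :
  'M[R]_(1 + 1))) (same_law_sym h2).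
apply: same_law_trans h4 _; apply: same_law_trans h2.
apply: same_law_ext h3 => // w /=.
rewrite mul_row_block -!scalar_mxM -!raddfD/=.
by rewrite mulrN ![_ * w.1]mulrC ![_ * w.2]mulrC.
Qed.

End invariance.

(** * Reduction of a matrix by rotations *)

Section orthogonal_reduction.
Context {R : realType}.

Definition sqnorm n (a : 'rV[R]_n) : R := (a *m a^T) 0 0.

Lemma sqnormE n (a : 'rV[R]_n) : sqnorm a = \sum_(i < n) a 0 i ^+ 2.
Proof. by rewrite /sqnorm mxE; apply: eq_bigr => i _; rewrite mxE expr2. Qed.

Lemma sqnorm_ge0 n (a : 'rV[R]_n) : 0 <= sqnorm a.
Proof. by rewrite sqnormE; apply: sumr_ge0 => i _; exact: sqr_ge0. Qed.

Lemma sqnorm_row n1 n2 (a : 'rV[R]_n1) (b : 'rV[R]_n2) :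
  sqnorm (row_mx a b) = sqnorm a + sqnorm b.
Proof. by rewrite /sqnorm tr_row_mx mul_row_col mxE. Qed.

Lemma sqnorm_scalar (x : R) : sqnorm (x%:M : 'rV[R]_1) = x ^+ 2.
Proof. by rewrite sqnormE big_ord1 mxE. Qed.

Definition norm2 n (a : 'rV[R]_n) : R := Num.sqrt (sqnorm a).

Lemma sqr_norm2 n (a : 'rV[R]_n) : norm2 a ^+ 2 = sqnorm a.
Proof. by rewrite sqr_sqrtr// sqnorm_ge0. Qed.

(** Invariance is bundled with orthogonality: both are inherited by products
    and diagonal blocks, and hold for plane rotations and for the sign
    change. *)
Definition gaussian_rotation n (Q : 'M[R]_n) :=
  gaussian_invariant Q /\ Q *m Q^T = 1%:M.

Lemma gaussian_rotation1 n : gaussian_rotation (1%:M : 'M[R]_n).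
Proof. by split; [exact: gaussian_invariant1|rewrite trmx1 mulmx1]. Qed.

Lemma gaussian_rotationM n (Q1 Q2 : 'M[R]_n) :
  gaussian_rotation Q1 -> gaussian_rotation Q2 -> gaussian_rotation (Q1 *m Q2).
Proof.
move=> [i1 o1] [i2 o2]; split; first exact: gaussian_invariantM.
by rewrite trmx_mul mulmxA -(mulmxA Q1) o2 mulmx1.
Qed.

Lemma gaussian_rotation_block n1 n2 (Q1 : 'M[R]_n1) (Q2 : 'M[R]_n2) :
  gaussian_rotation Q1 -> gaussian_rotation Q2 ->
  gaussian_rotation (block_mx Q1 0 0 Q2).
Proof.
move=> [i1 o1] [i2 o2]; split; first exact: gaussian_invariant_block.
by rewrite tr_block_mx mulmx_block !trmx0 !mulmx0 !mul0mx !addr0 add0r o1 o2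
  -scalar_mx_block.
Qed.

Lemma gaussian_rotation_plane (c s : R) : c ^+ 2 + s ^+ 2 = 1 ->
  gaussian_rotation (block_mx c%:M s%:M (- s)%:M c%:M : 'M[R]_(1 + 1)).
Proof.
move=> cs; split; first exact: gaussian_invariant_plane.
rewrite tr_block_mx mulmx_block !tr_scalar_mx -!scalar_mxM -!raddfD/=.
rewrite [1%:M in RHS]scalar_mx_block; congr block_mx.
- by rewrite -cs !expr2.
- by rewrite mulrN mulrC addNr raddf0.
- by rewrite mulrC mulrN addNr raddf0.
- by rewrite mulrNN -cs !expr2 addrC.
Qed.

(** By induction the tail of [a] is rotated to [(y, 0, .., 0)] with [y] its
    norm, and a plane rotation then takes [(x, y)] to [(z, 0)]. In dimension
    one only the sign of the entry has to be corrected. *)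
Lemma rotate_to_axis n (a : 'rV[R]_(1 + n)) :
  exists2 Q, gaussian_rotation Q & a *m Q = row_mx (norm2 a)%:M 0.
Proof.
elim: n => [|n IHn] in a *.
  (* The row is written with an empty right block in order to reuse block
     matrices. *)
  have [x ->] : exists x, a = row_mx x%:M 0.
    by exists (a 0 0); rewrite -[LHS]hsubmxK; congr row_mx;
       [rewrite [LHS]mx11_scalar mxE; congr (a _ _)%:M;
         exact: val_inj|rewrite thinmx0].
  have norm_x : norm2 (row_mx x%:M 0 : 'rV[R]_(1 + 0)) = `|x|.
    by rewrite /norm2 sqnorm_row sqnorm_scalar sqnormE big_ord0 addr0 sqrtr_sqr.
  rewrite norm_x; have [x0|x0] := leP 0 x.
    by exists 1%:M; [exact: gaussian_rotation1|rewrite mulmx1 ger0_norm].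
  exists (block_mx (-1%:M : 'M[R]_1) 0 0 (1%:M : 'M[R]_0)).
    apply: gaussian_rotation_block; last exact: gaussian_rotation1.
    by split; [exact: gaussian_invariantN1|rewrite raddfN/=
      trmx1 mulNmx mulmxN mulmx1 opprK].
  rewrite mul_row_block !mulmx0 !mul0mx !addr0 mulmxN mulmx1 ltr0_norm//.
  by rewrite raddfN.
have [x [b ->]] : exists x (b : 'rV[R]_(1 + n)), a = row_mx x%:M b.
  by exists (lsubmx a 0 0), (rsubmx a); rewrite -mx11_scalar hsubmxK.
have [Q1 r1 bQ1] := IHn b; set y := norm2 b in bQ1.
set z := norm2 (row_mx _ _).
have zE : z ^+ 2 = x ^+ 2 + y ^+ 2.
  by rewrite sqr_norm2 sqnorm_row sqnorm_scalar sqr_norm2.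
pose Q := block_mx 1%:M 0 0 Q1 : 'M[R]_(1 + (1 + n)).
have rQ : gaussian_rotation Q.
  exact: gaussian_rotation_block (gaussian_rotation1 1) r1.
have aQ : row_mx x%:M b *m Q = row_mx (row_mx x%:M y%:M :
  'rV[R]_(1 + 1)) 0 :> 'rV[R]_(1 + 1 + n).
  rewrite mul_row_block !mulmx0 mulmx1 addr0 add0r bQ1.
  by rewrite row_mxA castmx_id.
have [z0|z0] := eqVneq z 0.
  have /eqP := zE; rewrite z0 expr0n eq_sym paddr_eq0 ?sqr_ge0// !sqrf_eq0.
  move=> /andP[/eqP x0 /eqP y0]; exists Q => //; rewrite aQ x0 y0.
  by rewrite !raddf0 row_mx0 [LHS]row_mx0 row_mx0.
(* The plane rotation with cosine [x / z] and sine [- (y / z)]. *)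
pose G := block_mx (x / z)%:M (- (y / z))%:M (- - (y / z))%:M (x / z)%:M :
  'M[R]_(1 + 1).
have rG : gaussian_rotation G.
  apply: gaussian_rotation_plane; rewrite sqrrN !expr_div_n -mulrDl -zE divff//.
  by rewrite sqrf_eq0.
exists (Q *m block_mx G 0 0 1%:M).
  by apply: gaussian_rotationM => //; exact: gaussian_rotation_block rG
    (gaussian_rotation1 n).
transitivity (row_mx (row_mx x%:M y%:M : 'rV[R]_(1 + 1)) 0 *m
    (block_mx G 0 0 1%:M : 'M[R]_(1 + 1 + n))).
  by rewrite mulmxA; exact: (congr1 (mulmx^~ _) aQ).
rewrite mul_row_block !mulmx0 mul0mx addr0 add0r mul_row_block.
rewrite -!scalar_mxM -!raddfD/= opprK.
have -> : x * (x / z) + y * (y / z) = z.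
  by rewrite !mulrA -mulrDl -!expr2 -zE expr2 mulfK.
have -> : x * - (y / z) + y * (x / z) = 0 by rewrite mulrN mulrCA addNr.
rewrite raddf0; have := @row_mxA _ _ _ _ _ (z%:M : 'M[R]_1) (0 : 'M[R]_1) (0 :
  'M[R]_(1, n)).
by rewrite /= castmx_id row_mx0 => ->.
Qed.

(** Rotate the first row to the first axis, then apply the induction
    hypothesis to the other rows with their first entries removed. *)
Lemma rotate_to_trapezoid k q (B : 'M[R]_(k, k + q)) :
  exists2 Q, gaussian_rotation Q & exists L, B *m Q = row_mx L 0.
Proof.
elim: k => [|k IHk] in B *.
  exists 1%:M; first exact: gaussian_rotation1.
  by exists 0; rewrite [LHS]flatmx0 [RHS]flatmx0.
have [b [B1 ->]] : exists (b : 'rV[R]_(1 + (k + q))) (B1 : 'M[R]_(k,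
  1 + (k + q))),
    B = col_mx b B1.
  by exists (usubmx (B : 'M[R]_(1 + k, 1 + (k + q)))),
            (dsubmx (B : 'M[R]_(1 + k, 1 + (k + q)))); rewrite vsubmxK.
have [Q1 r1 bQ1] := rotate_to_axis b.
have [v [B2 BQ1]] : exists v (B2 : 'M[R]_(k, k + q)), B1 *m Q1 = row_mx v B2.
  by exists (lsubmx (B1 *m Q1)), (rsubmx (B1 *m Q1)); rewrite hsubmxK.
have [Q2 r2 [L2 B2Q2]] := IHk B2.
exists (Q1 *m (block_mx 1%:M 0 0 Q2 : 'M[R]_(1 + (k + q)))).
  apply: gaussian_rotationM => //.
  exact: gaussian_rotation_block (gaussian_rotation1 1) r2.
exists (block_mx (norm2 b)%:M 0 v L2 : 'M[R]_(1 + k)).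
transitivity ((col_mx b B1 : 'M[R]_(1 + k, 1 + (k + q))) *m
   (Q1 *m (block_mx 1%:M 0 0 Q2 : 'M[R]_(1 + (k + q))))) => //.
rewrite mulmxA mul_col_mx bQ1 BQ1 mul_col_mx !mul_row_block.
rewrite !mulmx0 !mulmx1 !mul0mx !addr0 !add0r B2Q2.
have e1 := @row_mxA _ _ _ _ _ v L2 (0 : 'M[R]_(k, q)).
have e2 := @row_mxA _ _ _ _ _ ((norm2 b)%:M : 'M[R]_1) (0 : 'M[R]_(1, k)) (0 :
  'M[R]_(1, q)).
move: e1 e2; rewrite /= !castmx_id row_mx0 => -> ->.
transitivity (block_mx (row_mx (norm2 b)%:M 0 : 'M[R]_(1, 1 + k)) (0 : 'M[R]_(1,
  q))
    (row_mx v L2) 0).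
  by rewrite block_mxEv.
by rewrite block_mxEh col_mx0 block_mxEv.
Qed.

(** As [Q] is orthogonal, the Gram products may be computed after rotation.
    Then [[L 0; B1 B2] [L 0; C1 C2]^T] factors as [[L 0; B1 1] * [L^T C1^T;
    0 B2 C2^T]], whose factors are block triangular. *)
Lemma det_gram_split c k q (A : 'M[R]_(c, c + q)) (B C : 'M[R]_(k, c + q))
    (Q : 'M[R]_(c + q)) (L : 'M[R]_c) :
  Q *m Q^T = 1%:M -> A *m Q = row_mx L 0 ->
  \det (col_mx A B *m (col_mx A C)^T) =
  \det (A *m A^T) * \det (rsubmx (B *m Q) *m (rsubmx (C *m Q))^T).
Proof.
move=> QQ AQ.
have key m1 m2 (X : 'M[R]_(m1, c + q)) (Y : 'M[R]_(m2, c + q)) :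
    X *m Y^T = (X *m Q) *m (Y *m Q)^T.
  by rewrite trmx_mul mulmxA -(mulmxA X) QQ mulmx1.
have -> : A *m A^T = L *m L^T.
  by rewrite key AQ tr_row_mx trmx0 mul_row_col mul0mx addr0.
have colQ (X : 'M[R]_(k, c + q)) :
    col_mx A X *m Q = block_mx L 0 (lsubmx (X *m Q)) (rsubmx (X *m Q)).
  by rewrite block_mxEv hsubmxK mul_col_mx AQ.
rewrite key !colQ.
set B1 := lsubmx _; set B2 := rsubmx _; set C1 := lsubmx _; set C2 := rsubmx _.
rewrite tr_block_mx trmx0 mulmx_block !mulmx0 !mul0mx !addr0.
have -> : block_mx (L *m L^T) (L *m C1^T) (B1 *m L^T) (B1 *m C1^T + B2 *m C2^T)
  =
    block_mx L 0 B1 1%:M *m block_mx L^T C1^T 0 (B2 *m C2^T).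
  by rewrite mulmx_block !mulmx0 !mul0mx !addr0 mul1mx.
by rewrite [LHS]det_mulmx det_lblock det_ublock det1 mulr1 [\det (L *m
  _)]det_mulmx det_tr mulrA.
Qed.

End orthogonal_reduction.

(** * Laws of determinants of Gaussian matrices *)

Section gaussian_determinants.
Context {R : realType}.

Lemma measurable_det_gram d (T : measurableType d) m n
    (f g : T -> 'M[R]_(m, n)) :
  measurable_fun [set: T] f -> measurable_fun [set: T] g ->
  measurable_fun [set: T] (fun x => \det (f x *m (g x)^T)).
Proof.
by move=> mf mg; apply: measurable_det; apply: measurable_mulmx => //;
  exact: measurable_trmx.
Qed.

Lemma measurable_sqnorm n : measurable_fun [set: 'rV[R]_n] (@sqnorm R n).
Proof.
apply: (measurableT_comp (measurable_mx_entry 0 0)).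
by apply: measurable_mulmx => //; exact: measurable_trmx.
Qed.

Lemma same_law_cst d1 d2 d' (T1 : measurableType d1) (T2 : measurableType d2)
    (S : measurableType d') (P1 : probability T1 R) (P2 : probability T2 R)
    (a : S) :
  same_law P1 (cst a) P2 (cst a).
Proof.
split => // A mA; rewrite /pushforward !preimage_cst.
by case: ifP; rewrite ?probability_setT ?measure0.
Qed.

(** The last columns of a rotated Gaussian matrix: this is the part of the
    blocks that survives in [det_gram_split]. *)
Lemma gaussian_rsubmx_rotation m c q (Q : 'M[R]_(c + q)) :
  gaussian_invariant Q ->
  same_law (gaussian m (c + q)) (fun X => rsubmx (X *m Q)) (gaussian m q) id.
Proof.
move=> hQ.
have mr : measurable_fun [set: 'M[R]_(m, c + q)] (fun X => rsubmx X).
  apply/measurable_fun_mxP => i j; under eq_fun do rewrite mxE.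
  exact: measurable_mx_entry.
apply: same_law_trans (same_law_comp mr (hQ m)) _.
apply: same_law_trans (same_law_comp mr (same_law_sym (@gaussian_row R m c q)))
  _.
apply: same_law_ext (same_law_snd (gaussian m c) (gaussian m q)) => // w /=.
by rewrite row_mxKr.
Qed.

Lemma gaussian_lsubmx_rotation m c q (Q : 'M[R]_(c + q)) :
  gaussian_invariant Q ->
  same_law (gaussian m (c + q)) (fun X => lsubmx (X *m Q)) (gaussian m c) id.
Proof.
move=> hQ.
have mr : measurable_fun [set: 'M[R]_(m, c + q)] (fun X => lsubmx X).
  apply/measurable_fun_mxP => i j; under eq_fun do rewrite mxE.
  exact: measurable_mx_entry.
apply: same_law_trans (same_law_comp mr (hQ m)) _.
apply: same_law_trans (same_law_comp mr (same_law_sym (@gaussian_row R m c q)))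
  _.
apply: same_law_ext (same_law_fst (gaussian m c) (gaussian m q)) => // w /=.
by rewrite row_mxKl.
Qed.

Lemma measurable_fst_det_gram c n d (T : measurableType d) (g : T -> R) :
  measurable_fun [set: T] g ->
  measurable_fun [set: 'M[R]_(c, n) * T] (fun w => \det (w.1 *m w.1^T) * g w.2).
Proof.
move=> mg; apply: measurable_funM; first exact: measurable_det_gram.
exact: measurableT_comp.
Qed.

(** Given [A], rotate [B] and [C] by the [Q] that reduces [A]; the remaining
    factor does not see [A]. *)
Lemma law_det_gram2 c k q :
  same_law (gaussian c (c + q) \x (gaussian k (c + q) \x gaussian k (c + q)))%E
    (fun w => \det (col_mx w.1 w.2.1 *m (col_mx w.1 w.2.2)^T) : R)
    (gaussian c (c + q) \x (gaussian k q \x gaussian k q))%E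
    (fun w => \det (w.1 *m w.1^T) * \det (w.2.1 *m w.2.2^T)).
Proof.
apply: same_law_cond.
- apply: measurable_det_gram; apply: measurable_col_mx => //;
  exact: measurableT_comp.
- apply: (measurable_fst_det_gram (T := ('M[R]_(k, q) * 'M[R]_(k, q))%type)
    (g := fun w => \det (w.1 *m w.2^T))).
  exact: measurable_det_gram.
move=> A /=; have [Q [iQ oQ] [L AQ]] := rotate_to_trapezoid A.
have h := gaussian_rsubmx_rotation k iQ.
have mg : measurable_fun [set: 'M[R]_(k, q) * 'M[R]_(k, q)]
    (fun w => \det (A *m A^T) * \det (w.1 *m w.2^T)).
  by apply: measurable_funM => //; exact: measurable_det_gram.
apply: same_law_ext (same_law_comp mg (same_law_pair h h)) => // -[B C] /=.
by rewrite (det_gram_split B C oQ AQ).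
Qed.

(** The diagonal case [B = C] of [law_det_gram2], which is not a special
    case of it since there [B] and [C] are independent. *)
Lemma law_det_gram1 c k q :
  same_law (gaussian c (c + q) \x gaussian k (c + q))%E
    (fun w => \det (col_mx w.1 w.2 *m (col_mx w.1 w.2)^T) : R)
    (gaussian c (c + q) \x gaussian k q)%E
    (fun w => \det (w.1 *m w.1^T) * \det (w.2 *m w.2^T)).
Proof.
apply: same_law_cond.
- by apply: measurable_det_gram; exact: measurable_col_mx.
- apply: (measurable_fst_det_gram (T := 'M[R]_(k, q))
    (g := fun w => \det (w *m w^T))).
  exact: measurable_det_gram.
move=> A /=; have [Q [iQ oQ] [L AQ]] := rotate_to_trapezoid A.
have h := gaussian_rsubmx_rotation k iQ.
have mg : measurable_fun [set: 'M[R]_(k, q)]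
    (fun w => \det (A *m A^T) * \det (w *m w^T)).
  by apply: measurable_funM => //; exact: measurable_det_gram.
apply: same_law_ext (same_law_comp mg h) => // B /=.
by rewrite (det_gram_split B B oQ AQ).
Qed.

(** [law_det_gram1] for a first block consisting of one row, whose Gram
    determinant is its squared norm. *)
Lemma law_det_gramS c n :
  same_law (gaussian (1 + c) (1 + n)) (fun A => \det (A *m A^T) : R)
    (gaussian 1 (1 + n) \x gaussian c n)%E
    (fun w => sqnorm w.1 * \det (w.2 *m w.2^T)).
Proof.
have md : measurable_fun [set: 'M[R]_(1 + c, 1 + n)] (fun A => \det (A *m A^T)).
  exact: measurable_det_gram.
apply: same_law_trans (same_law_comp md (same_law_sym (@gaussian_col R 1 c (1 +
  n)))) _.
by apply: same_law_ext (@law_det_gram1 1 c n) => // w /=; rewrite det_mx11.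
Qed.

(** Changing the sign of the first column preserves the law of the matrix
    and changes the sign of its determinant. *)
Lemma det_gaussian_sym k : (0 < k)%N ->
  same_law (gaussian k k) (fun Z => - \det Z : R)
    (gaussian k k) (fun Z => \det Z).
Proof.
case: k => // k _.
have md : measurable_fun [set: 'M[R]_(k.+1)] (fun A =>
  \det A) by exact: measurable_det.
have h := gaussian_invariant_block (@gaussian_invariantN1 R)
  (@gaussian_invariant1 R k).
apply: same_law_ext (same_law_comp md (h k.+1)) => // Z /=.
have e : \det (block_mx (-1%:M : 'M[R]_1) 0 0 (1%:M : 'M[R]_k)) = -1.
  by rewrite det_lblock det1 mulr1 det_mx11 !mxE.
by apply: (etrans (det_mulmx _ _)); apply: (etrans (congr1 ( *%R _) e));
  rewrite mulrN1.
Qed.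

(** Given [B] with [B Q = [L 0]], the product [B C^T] only involves the
    first [k] columns of [C Q], which form a square Gaussian matrix;
    moreover [B B^T = L L^T]. A negative [\det L] is compensated by
    [det_gaussian_sym]. *)
Lemma law_det_cross k q :
  same_law (gaussian k (k + q) \x gaussian k (k + q))%E
    (fun w => \det (w.1 *m w.2^T) : R)
    (gaussian k (k + q) \x gaussian k k)%E
    (fun w => Num.sqrt (\det (w.1 *m w.1^T)) * \det w.2).
Proof.
apply: same_law_cond.
- exact: measurable_det_gram.
- apply: measurable_funM; last exact: measurable_det.
  apply: measurableT_comp; last exact: measurable_det_gram.
  by apply: continuous_measurable_fun; exact: sqrt_continuous.
move=> B /=; have [Q [iQ oQ] [L BQ]] := rotate_to_trapezoid B.
have key m1 m2 (X : 'M[R]_(m1, k + q)) (Y : 'M[R]_(m2, k + q)) :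
    X *m Y^T = (X *m Q) *m (Y *m Q)^T.
  by rewrite trmx_mul mulmxA -(mulmxA X) oQ mulmx1.
have -> : B *m B^T = L *m L^T.
  by rewrite key BQ tr_row_mx trmx0 mul_row_col mul0mx addr0.
rewrite det_mulmx det_tr -expr2 sqrtr_sqr.
have mg (a : R) : measurable_fun [set: 'M[R]_k] (fun Z => a * \det Z).
  by apply: measurable_funM => //; exact: measurable_det.
have h := same_law_comp (mg (\det L)) (gaussian_lsubmx_rotation k iQ).
apply: (same_law_trans (P2 := gaussian k k) (X2 := fun Z => \det L * \det Z)).
  apply: same_law_ext h => // C /=.
  rewrite key BQ -[C *m Q in RHS]hsubmxK tr_row_mx mul_row_col mul0mx addr0.
  by rewrite det_mulmx det_tr.
have [L0|L0] := leP 0 (\det L).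
  by rewrite ger0_norm//; exact: same_law_refl.
have k0 : (0 < k)%N.
  by case: k L L0 {B Q iQ oQ BQ key mg h} => // L; rewrite det_mx00 ltNge ler01.
rewrite ltr0_norm//.
have mm : measurable_fun [set: R] (fun x =>
  - \det L * x) by exact: measurable_funM.
apply: same_law_ext (same_law_comp mm (det_gaussian_sym k0)) => // Z /=.
by rewrite mulrNN.
Qed.

(** The function [h] allows both uses of the lemma: [h = id] for the factors
    [W_i] and [h = Num.sqrt] for the factors [Num.sqrt W_i]. The restriction
    [0 <= x] is what [Num.sqrt] satisfies; it suffices as squared norms are
    nonnegative. *)
Lemma law_prod_chi (h : R -> R) : measurable_fun [set: R] h -> h 1 = 1 ->
    (forall x y, 0 <= x -> h (x * y) = h x * h y) ->
  forall c n (mu : 'I_c -> probability R R), (c <= n)%N ->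
    (forall i : 'I_c, same_law (mu i) id (gaussian 1 (n - i)) (@sqnorm R _)) ->
  same_law (product_mx (fun _ : 'I_1 => mu)) (fun v => \prod_i h (v 0 i))
    (gaussian c n) (fun A => h (\det (A *m A^T))).
Proof.
move=> mh h1 hM; elim=> [|c IHc] n mu cn hmu.
  apply: same_law_ext (same_law_cst (product_mx (fun _ : 'I_1 =>
    mu)) (gaussian 0 n) (1 : R)) => A.
    by rewrite big_ord0.
  by rewrite det_mx00.
case: n cn hmu => // n cn hmu.
have md : measurable_fun [set: 'rV[R]_(1 + c)] (fun v : 'rV[R]_(1 + c) =>
  \prod_i h (v 0 i)).
  apply: measurable_prod => i _; apply: measurableT_comp => //.
  exact: measurable_mx_entry.
have hr := @product_mx_row R 1 1 c (fun _ => mu).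
apply: same_law_trans (same_law_comp md (same_law_sym hr)) _.
have h0 : same_law (product_mx (fun _ (j : 'I_1) => mu (lshift c j))) (fun v :
  'M[R]_1 => v 0 0)
    (gaussian 1 (1 + n)) (@sqnorm R _).
  apply: same_law_trans (hmu 0).
  have me := @measurable_mx_entry _ R 1 1 0 0.
  have e : (fun _ (j : 'I_1) => mu (lshift c j)) = (fun _ _ => mu 0)
      :> ('I_1 -> 'I_1 -> probability R R).
    by apply: funext => _; apply: funext => j; congr mu; apply: val_inj;
      rewrite ord1.
  rewrite e.
  apply: same_law_ext (same_law_comp me
    (same_law_sym (product_mx_scalar (mu 0)))) => // x /=.
  by rewrite mxE.
have hc : same_law (product_mx (fun (_ : 'I_1) j => mu (rshift 1 j)))
    (fun v => \prod_i h (v 0 i)) (gaussian c n) (fun A => h (\det (A *m A^T))).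
  by apply: IHc => // i; exact: (hmu (rshift 1 i)).
have mM : measurable_fun [set: R * R] (fun w => h w.1 * w.2).
  by apply: measurable_funM => //; exact: measurableT_comp.
have h2 := same_law_comp mM (same_law_pair h0 hc).
apply: (same_law_trans (same_law_ext _ _ h2)) => [w||] /=.
- rewrite big_split_ord big_ord1/= row_mxEl; congr (_ * _).
  by apply: eq_bigr => i _; rewrite row_mxEr.
- move=> w; reflexivity.
apply: same_law_ext (same_law_comp mh (same_law_sym (law_det_gramS c n))) =>
  // w /=.
by rewrite hM// sqnorm_ge0.
Qed.

End gaussian_determinants.

(** * Moments of the normal law *)

Section normal_moments.
Local Open Scope ereal_scope.
Context {R : realType}.
Local Notation mu := (@lebesgue_measure R).
Local Notation TR := (measurableTypeR R).
Local Notation phi := (normal_pdf (0:R) 1).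

Let phiE x : phi x = (normal_peak 1 * expR (- (x ^+ 2 / 2)))%R.
Proof. by rewrite normal_pdfE ?oner_eq0// /normal_fun subr0 expr1n mulNr. Qed.

Let is_derive_phi (x : R) : is_derive x 1%R phi (- (x * phi x))%R.
Proof.
rewrite (_ : phi = fun x => normal_peak 1 * expR (- (x ^+ 2 / 2)))%R;
  last first.
  by apply/funext => y; exact: phiE.
apply: is_derive_eq.
rewrite /GRing.scale/=.
lra.
Qed.

(** Provides the boundary term in [integral_tail]. *)
Let cvg_phi : phi x @[x --> +oo%R] --> (0 : R)%R.
Proof.
rewrite (_ : phi = fun x => normal_peak 1 * expR (- (x ^+ 2 / 2)))%R;
  last first.
  by apply/funext => y; exact: phiE.
rewrite -[X in _ --> X](mulr0 (normal_peak (1 : R))).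
apply: cvgM; first exact: cvg_cst.
apply: (cvg_comp (fun x : R => x ^+ 2 / 2)%R (fun x => expR (- x)));
  last exact: cvgr_expR.
by apply/gt0_cvgMly; [rewrite invr_gt0|exact: cvgr_expr2].
Qed.

Let continuous_phi : continuous phi.
Proof. exact: continuous_normal_pdf (oner_neq0 _). Qed.

Let integral_tail (t : R) : (0 <= t)%R ->
  \int[mu]_(x in `[t, +oo[) (x * phi x)%:E = (phi t)%:E.
Proof.
move=> t0; rewrite (@ge0_continuous_FTC2y _ _ (fun x => - phi x)%R _ 0%R).
- by rewrite -EFinB opprK add0r.
- by move=> x tx; rewrite mulr_ge0 ?normal_pdf_ge0// (le_trans t0).
- apply: continuous_subspaceT => x; apply: cvgM; first exact: cvg_id.
  exact: continuous_phi.
- by rewrite -[X in _ --> X]oppr0; apply: cvgN; exact: cvg_phi.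
- by move=> x _; apply: derivableN; have [] := is_derive_phi x.
- by apply: cvg_at_right_filter; apply: cvgN; exact: continuous_phi.
- move=> x _; rewrite derive1E deriveN; last by have [] := is_derive_phi x.
  by have [_ ->] := is_derive_phi x; rewrite opprK.
Qed.

Let integral_power (p : nat) (x : R) : (0 <= x)%R ->
  \int[mu]_(t in `[0%R, x]) (p.+1%:R * t ^+ p)%:E = (x ^+ p.+1)%:E.
Proof.
rewrite le_eqVlt => /orP[/eqP <-|x0].
  by rewrite set_itv1 integral_set1 expr0n.
rewrite (@continuous_FTC2 _ _ (fun t => t ^+ p.+1)%R)//.
- by rewrite expr0n sube0.
- apply: continuous_subspaceT => t; apply: cvgM; first exact: cvg_cst.
  exact: exprn_continuous.
- split.
  + by move=> t _; exact: exprn_derivable.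
  + by apply: cvg_at_right_filter; exact: exprn_continuous.
  + by apply: cvg_at_left_filter; exact: exprn_continuous.
- by move=> t _; rewrite derive1E exp_derive /GRing.scale/= mulr1.
Qed.

(** Integration by parts in the form of Tonelli's theorem: write [x ^+ p.+1]
    as the integral of [p.+1%:R * t ^+ p] over [`[0, x]], exchange the
    integrals, and use that the integral of [x * phi x] beyond [t] is [phi
    t]. *)
Let half_moment (p : nat) :
  \int[mu]_(x in `[0%R, +oo[) (x ^+ p.+2 * phi x)%:E =
  p.+1%:R%:E * \int[mu]_(x in `[0%R, +oo[) (x ^+ p * phi x)%:E.
Proof.
(* The integrand on the region [0 <= t <= x], where [w] is [(x, t)]. *)
pose h (w : TR * TR) : \bar R := (if (0 <= w.2)%R && (w.2 <= w.1)%R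
  then (p.+1%:R * w.2 ^+ p) * (w.1 * phi w.1) else 0)%R%:E.
have mh : measurable_fun [set: TR * TR] h.
  apply/measurable_EFinP; apply: measurable_fun_ifT => //=.
    by apply: measurable_and; apply: measurable_fun_ler.
  apply: measurable_funM.
    by apply: measurable_funM => //; apply: measurable_funX.
  apply: measurable_funM => //; apply: measurableT_comp => //.
  exact: measurable_normal_pdf.
have h0 w : 0 <= h w.
  rewrite lee_fin /h; case: ifP => // /andP[t0 tx].
  by rewrite !mulr_ge0 ?exprn_ge0 ?normal_pdf_ge0// (le_trans t0).
transitivity (\int[mu]_x \int[mu]_t h (x, t)).
  rewrite integral_mkcond; apply: eq_integral => x _; rewrite patchE.
  have [x0|x0] := boolP (x \in `[0%R, +oo[%classic); last first.
    rewrite integral0_eq// => t _; rewrite /h/=; case: ifP => // /andP[t0 tx].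
    by move: x0; rewrite notin_setE/= in_itv/= andbT (le_trans t0 tx).
  have {}x0 : (0 <= x)%R by move: x0; rewrite inE/= in_itv/= andbT.
  transitivity (\int[mu]_(t in `[0%R, x]) ((p.+1%:R * t ^+ p)%:E * (x * phi
    x)%:E)).
    rewrite ge0_integralZr//.
    - by rewrite integral_power// -EFinM mulrA -exprSr.
    - apply/measurable_EFinP/measurable_funM => //; exact: measurable_funX.
    - move=> t /=; rewrite in_itv/= => /andP[t0 _].
      by rewrite lee_fin mulr_ge0// exprn_ge0.
    - by rewrite lee_fin mulr_ge0// normal_pdf_ge0.
  rewrite integral_mkcond; apply: eq_integral => t _; rewrite patchE /h/=.
  rewrite mem_setE in_itv/=; case: ifP => //.
rewrite fubini_tonelli// -ge0_integralZl//; last 2 first.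
- apply/measurable_EFinP; apply: measurable_funTS; apply: measurable_funM => //.
  exact: measurable_normal_pdf.
- move=> x /=; rewrite in_itv/= andbT => x0.
  by rewrite lee_fin mulr_ge0 ?exprn_ge0 ?normal_pdf_ge0.
rewrite [RHS]integral_mkcond; apply: eq_integral => t _; rewrite patchE.
have [t0|t0] := boolP (t \in `[0%R, +oo[%classic); last first.
  rewrite integral0_eq// => x _; rewrite /h/=; case: ifP => // /andP[t0' tx].
  by move: t0; rewrite notin_setE/= in_itv/= andbT t0'.
have {}t0 : (0 <= t)%R by move: t0; rewrite inE/= in_itv/= andbT.
transitivity (\int[mu]_(x in `[t, +oo[) ((p.+1%:R * t ^+ p)%:E * (x * phi
  x)%:E)).
  rewrite [RHS]integral_mkcond; apply: eq_integral => x _; rewrite patchE /h/=.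
  by rewrite mem_setE in_itv/= andbT t0/=; case: ifP.
rewrite ge0_integralZl//.
- by rewrite integral_tail// -!EFinM mulrA.
- apply/measurable_EFinP; apply: measurable_funTS; apply: measurable_funM => //.
  exact: measurable_normal_pdf.
- move=> x /=; rewrite in_itv/= andbT => tx.
  by rewrite lee_fin mulr_ge0 ?normal_pdf_ge0// (le_trans t0).
- by rewrite lee_fin mulr_ge0// exprn_ge0.
Qed.

(** For even [p] the integrand is even, and the integral is twice the
    integral over the half-line. *)
Lemma normal_moment_rec (p : nat) : ~~ odd p ->
  \int[@normal_law R]_x (x ^+ p.+2)%:E =
  p.+1%:R%:E * \int[@normal_law R]_x (x ^+ p)%:E.
Proof.
have full q : ~~ odd q -> \int[@normal_law R]_x (x ^+ q)%:E =
    2%:E * \int[mu]_(x in `[0%R, +oo[) (x ^+ q * phi x)%:E.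
  move=> oq.
  have x0 (x : R) : (0 <= x ^+ q)%R by rewrite exprn_even_ge0.
  have mx : measurable_fun [set: R] (fun x : R => (x ^+ q)%:E).
    by apply/measurable_EFinP; exact: measurable_funX.
  rewrite -(same_law_integral mx (fun x => x0 x)
    (same_law_image (normal_prob 0 1 : probability TR R)
      (X := idfun : TR -> R) (@measurable_id _ _ _))).
  rewrite (ge0_integral_normal mx)//.
  under eq_integral do rewrite -EFinM.
  rewrite (ge0_symfun_integralT (f := fun x => (x ^+ q * phi x)%R)).
  - congr (_ * _); congr (integral _ _ _).
    by apply/seteqP; split => x /=; rewrite in_itv/= andbT.
  - by move=> x; rewrite mulr_ge0 ?normal_pdf_ge0.
  - by move=> x; apply: cvgM; [exact: exprn_continuous|exact: continuous_phi].
  - move=> x; rewrite /= !phiE sqrrN; congr (_ * _)%R.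
    by rewrite exprNn -signr_odd (negbTE oq) expr0 mul1r.
move=> op; rewrite !full//; last by rewrite /= negbK.
by rewrite half_moment muleCA.
Qed.

Lemma normal_moment2 : \int[@normal_law R]_x (x ^+ 2)%:E = (1%R : R)%:E.
Proof.
rewrite normal_moment_rec//.
under eq_integral do rewrite expr0.
by rewrite integral_cst//= probability_setT !mul1e.
Qed.

Lemma normal_moment4 : \int[@normal_law R]_x (x ^+ 4)%:E = (3%R : R)%:E.
Proof. by rewrite normal_moment_rec// normal_moment2 mule1. Qed.

End normal_moments.

(** * Moments of Gram determinants *)

Section moments.
Local Open Scope ereal_scope.
Context {R : realType}.

Lemma integral_product d1 d2 (T1 : measurableType d1) (T2 : measurableType d2)
    (P1 : probability T1 R) (P2 : probability T2 R)
    (f : T1 -> R) (g : T2 -> R) :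
  measurable_fun [set: T1] f -> measurable_fun [set: T2] g ->
  (forall x, (0 <= f x)%R) -> (forall x, (0 <= g x)%R) ->
  \int[P1 \x P2]_w (f w.1 * g w.2)%:E =
  \int[P1]_x (f x)%:E * \int[P2]_y (g y)%:E.
Proof.
move=> mf mg f0 g0.
have mfg : measurable_fun [set: T1 * T2] (fun w => (f w.1 * g w.2)%:E).
  apply/measurable_EFinP/measurable_funM; exact: measurableT_comp.
rewrite (fubini_tonelli1 (fun w : T1 * T2 => (f w.1 * g w.2)%:E))//; last first.
  by move=> w; rewrite lee_fin mulr_ge0.
rewrite /fubini_F/= -ge0_integralZr//; last 3 first.
- exact/measurable_EFinP.
- by move=> x _; rewrite lee_fin.
- by apply: integral_ge0 => y _; rewrite lee_fin.
apply: eq_integral => x _; rewrite -ge0_integralZl//.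
- exact/measurable_EFinP.
- by move=> y _; rewrite lee_fin.
- by rewrite lee_fin.
Qed.

Lemma integral_probability1 d (T : measurableType d) (P : probability T R) :
  \int[P]_x (1%R : R)%:E = 1.
Proof. by rewrite integral_cst//= probability_setT mule1. Qed.

(** The first entry of a Gaussian row is independent of the others. *)
Lemma law_sqnormS n :
  same_law (gaussian 1 (1 + n)) (@sqnorm R _)
    (normal_law \x gaussian 1 n) (fun w => (w.1 ^+ 2 + sqnorm w.2)%R).
Proof.
have mr : measurable_fun [set: 'M[R]_1 * 'M[R]_(1, n)] (fun w =>
  row_mx w.1 w.2).
  exact: measurable_row_mx.
have h1 := same_law_pair (@gaussian_scalar R) (same_law_refl (gaussian 1 n)
  (@measurable_id _ 'rV[R]_n setT)).
have h2 := same_law_trans (same_law_comp mr h1) (@gaussian_row R 1 1 n).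
apply: same_law_sym.
apply: same_law_ext (same_law_comp (@measurable_sqnorm R _) h2) => // w /=.
by rewrite sqnorm_row sqnorm_scalar.
Qed.

(** The norm turns the identity into a nonnegative function on the whole
    line, to which [same_law_integral] applies. *)
Lemma same_law_moment d1 d2 (T1 : measurableType d1) (T2 : measurableType d2)
    (P1 : probability T1 R) (X1 : T1 -> R)
    (P2 : probability T2 R) (X2 : T2 -> R) :
  same_law P1 X1 P2 X2 ->
  (forall x, (0 <= X1 x)%R) -> (forall x, (0 <= X2 x)%R) ->
  \int[P1]_x (X1 x)%:E = \int[P2]_x (X2 x)%:E.
Proof.
move=> h X10 X20.
have mn : measurable_fun [set: R] (fun x => `|x|%:E).
  by apply/measurable_EFinP; exact: normr_measurable.
have := same_law_integral mn (fun x => normr_ge0 x) h.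
under eq_integral do rewrite ger0_norm//.
by under [RHS]eq_integral do rewrite ger0_norm//.
Qed.

Lemma integral_product_sum d1 d2 (T1 : measurableType d1)
    (T2 : measurableType d2)
    (P1 : probability T1 R) (P2 : probability T2 R)
    (f : T1 -> R) (g : T2 -> R) :
  measurable_fun [set: T1] f -> measurable_fun [set: T2] g ->
  (forall x, (0 <= f x)%R) -> (forall x, (0 <= g x)%R) ->
  \int[P1 \x P2]_w (f w.1 + g w.2)%:E =
  \int[P1]_x (f x)%:E + \int[P2]_y (g y)%:E.
Proof.
move=> mf mg f0 g0.
under eq_integral do rewrite EFinD.
rewrite ge0_integralD//; last 4 first.
- by move=> w _; rewrite lee_fin.
- by apply/measurable_EFinP; exact: measurableT_comp.
- by move=> w _; rewrite lee_fin.
- by apply/measurable_EFinP; exact: measurableT_comp.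
congr (_ + _).
- apply: same_law_moment => //.
  exact: same_law_comp mf (same_law_fst P1 P2).
- apply: same_law_moment => //.
  exact: same_law_comp mg (same_law_snd P1 P2).
Qed.

Lemma sqnorm_moment1 n : \int[@gaussian R 1 n]_a (sqnorm a)%:E = (n%:R : R)%:E.
Proof.
elim: n => [|n IHn].
  by rewrite integral0_eq// => a _; rewrite sqnormE big_ord0.
rewrite (same_law_moment (law_sqnormS n))//; last 2 first.
- by move=> a; exact: sqnorm_ge0.
- by move=> w; rewrite addr_ge0 ?sqr_ge0 ?sqnorm_ge0.
rewrite (integral_product_sum normal_law (gaussian 1 n) (f := fun x : R =>
  (x ^+ 2)%R) (g := @sqnorm R n))//.
- by rewrite normal_moment2 IHn -EFinD -natr1 addrC.
- exact: measurable_sqnorm.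
- by move=> x; exact: sqr_ge0.
- by move=> a; exact: sqnorm_ge0.
Qed.

Lemma sqnorm_moment2 n :
  \int[@gaussian R 1 n]_a (sqnorm a ^+ 2)%:E = ((n * (n + 2))%:R : R)%:E.
Proof.
elim: n => [|n IHn].
  by rewrite integral0_eq// => a _; rewrite sqnormE big_ord0 expr0n.
have msq : measurable_fun [set: R] (fun x : R =>
  x ^+ 2)%R by exact: measurable_funX.
have mS := @measurable_sqnorm R n.
have S0 := @sqnorm_ge0 R n.
rewrite (same_law_moment (same_law_comp msq (law_sqnormS n)))//=; last 2 first.
- by move=> a; exact: sqr_ge0.
- by move=> w; exact: sqr_ge0.
(* With [x] standard normal and [S] the squared norm of the other entries,
   expand [(x ^+ 2 + S) ^+ 2]; the mixed term factors by independence. *)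
transitivity (\int[normal_law \x gaussian 1 n]_w
    ((w.1 ^+ 4)%:E + ((2 * w.1 ^+ 2 * sqnorm w.2)%:E + (sqnorm w.2 ^+ 2)%:E)) :
      \bar R).
  by apply: eq_integral => w _; rewrite -!EFinD; congr EFin; ring.
have mq p : measurable_fun [set: R * 'rV[R]_n] (fun w => w.1 ^+ p)%R.
  by apply: measurable_funX; exact: measurable_fst.
have mS2 : measurable_fun [set: R * 'rV[R]_n] (fun w => sqnorm w.2).
  by apply: measurableT_comp mS _; exact: measurable_snd.
have m1 : measurable_fun [set: R * 'rV[R]_n] (fun w => (w.1 ^+ 4)%:E).
  exact/measurable_EFinP.
have m2 : measurable_fun [set: R * 'rV[R]_n] (fun w =>
  (2 * w.1 ^+ 2 * sqnorm w.2)%:E).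
  by apply/measurable_EFinP/measurable_funM => //; apply: measurable_funM.
have m3 : measurable_fun [set: R * 'rV[R]_n] (fun w => (sqnorm w.2 ^+ 2)%:E).
  by apply/measurable_EFinP/measurable_funX.
have p1 (w : R * 'rV[R]_n) : 0 <= (w.1 ^+ 4)%:E.
  by rewrite lee_fin exprn_even_ge0.
have p2 (w : R * 'rV[R]_n) : 0 <= (2 * w.1 ^+ 2 * sqnorm w.2)%:E.
  by rewrite lee_fin mulr_ge0 ?S0// mulr_ge0 ?sqr_ge0.
have p3 (w : R * 'rV[R]_n) : 0 <= (sqnorm w.2 ^+ 2)%:E.
  by rewrite lee_fin sqr_ge0.
rewrite ge0_integralD//; last 2 first.
- by move=> w _; rewrite adde_ge0.
- exact: emeasurable_funD.
rewrite ge0_integralD//.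
have -> : \int[normal_law \x gaussian 1 n]_w (w.1 ^+ 4)%:E = (3%R : R)%:E.
  rewrite -normal_moment4; apply: same_law_moment => [|w|x];
    rewrite ?exprn_even_ge0//.
  exact: same_law_comp (measurable_funX 4 (@measurable_id _ R setT))
    (same_law_fst _ _).
have -> : \int[normal_law \x gaussian 1 n]_w (sqnorm w.2 ^+ 2)%:E =
  ((n * (n + 2))%:R : R)%:E.
  rewrite -IHn; apply: same_law_moment => [|w|x]; rewrite ?sqr_ge0//.
  exact: same_law_comp (measurable_funX 2 mS) (same_law_snd _ _).
rewrite (integral_product normal_law (gaussian 1 n) (f := fun x : R =>
  (2 * x ^+ 2)%R)
  (g := @sqnorm R n)).
- rewrite (_ : \int[normal_law]_x _ = (2%R : R)%:E).
    by rewrite sqnorm_moment1 -!EFinM -!EFinD; congr EFin;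
      rewrite -natr1 !natrM !natrD; ring.
  under eq_integral do rewrite EFinM.
  rewrite ge0_integralZl//; [by rewrite normal_moment2
    mule1|exact/measurable_EFinP|by move=> x _; rewrite lee_fin sqr_ge0].
- by apply: measurable_funM => //; exact: msq.
- exact: mS.
- by move=> x; rewrite mulr_ge0 ?sqr_ge0.
- exact: S0.
Qed.

(** The recursion [law_det_gramS] multiplies moments. The absolute value
    makes the integrand visibly nonnegative for any [c] and [n]. *)
Lemma abs_det_gram_moment (s : nat) (M : nat -> R) :
  (forall n, \int[@gaussian R 1 n]_a (sqnorm a ^+ s)%:E = (M n)%:E) ->
  forall c n, (c <= n)%N ->
  \int[@gaussian R c n]_A (`|\det (A *m A^T)| ^+ s)%:E =
  (\prod_(i < c) M (n - i)%N)%:E.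
Proof.
move=> hM; elim=> [|c IHc] n cn.
  under eq_integral do rewrite det_mx00 normr1 expr1n.
  by rewrite big_ord0 integral_probability1.
case: n cn => // n cn.
have ms : measurable_fun [set: R] (fun x : R => `|x| ^+ s)%R.
  exact: measurable_funX (@normr_measurable R setT).
rewrite (same_law_moment (same_law_comp ms (@law_det_gramS R c n)))//=.
under eq_integral do rewrite normrM exprMn.
rewrite (integral_product (gaussian 1 (1 + n)) (gaussian c n)
  (f := fun a : 'rV[R]_(1 + n) => (`|sqnorm a| ^+ s)%R)
  (g := fun A : 'M[R]_(c, n) => (`|\det (A *m A^T)| ^+ s)%R)); last 4 first.
- by apply: measurableT_comp ms _; exact: measurable_sqnorm.
- by apply: measurableT_comp ms _; exact: measurable_det_gram.
- by move=> a; rewrite exprn_ge0.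
- by move=> A; rewrite exprn_ge0.
under [X in (X * _)%E]eq_integral do rewrite ger0_norm ?sqnorm_ge0//.
by rewrite hM IHc// -EFinM big_ord_recl subn0.
Qed.

(** After rotation the Gram matrix is [L L^T] with [L] square. *)
Lemma det_gram_ge0 c q (A : 'M[R]_(c, c + q)) : (0 <= \det (A *m A^T))%R.
Proof.
have [Q [_ oQ] [L AQ]] := rotate_to_trapezoid A.
have -> : A *m A^T = (A *m Q) *m (A *m Q)^T.
  by rewrite trmx_mul mulmxA -(mulmxA A) oQ mulmx1.
rewrite AQ tr_row_mx trmx0 mul_row_col mul0mx addr0.
by rewrite det_mulmx det_tr -expr2 sqr_ge0.
Qed.

Lemma prod_falling c n : (c <= n)%N ->
  (\prod_(i < c) (n - i)%:R = n`!%:R / (n - c)`!%:R :> R)%R.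
Proof.
elim: c n => [|c IHc] n cn.
  by rewrite big_ord0 subn0 divff// pnatr_eq0 -lt0n fact_gt0.
case: n cn => // n cn; rewrite big_ord_recl subn0 /= IHc//.
by rewrite factS natrM mulrA.
Qed.

Lemma det_gram_moment1 c q :
  \int[@gaussian R c (c + q)]_A (\det (A *m A^T))%:E =
  ((c + q)`!%:R / q`!%:R)%R%:E.
Proof.
have := @abs_det_gram_moment 1 (fun n => n%:R)%R sqnorm_moment1 c (c + q)%N
  (leq_addr _ _).
rewrite prod_falling ?leq_addr// addKn => <-.
by apply: eq_integral => A _; rewrite expr1 ger0_norm// det_gram_ge0.
Qed.

Lemma det_gram_moment2 c q :
  \int[@gaussian R c (c + q)]_A (\det (A *m A^T) ^+ 2)%:E =
  ((c + q)`!%:R / q`!%:R * ((c + q + 2)`!%:R / (q + 2)`!%:R))%R%:E.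
Proof.
have := @abs_det_gram_moment 2 (fun n => (n * (n + 2))%:R)%R sqnorm_moment2 c
  (c + q)%N (leq_addr _ _).
under eq_integral do rewrite real_normK ?num_real//.
move=> ->; congr EFin.
under eq_bigr do rewrite natrM.
rewrite big_split/= prod_falling ?leq_addr// addKn; congr (_ * _)%R.
under eq_bigr => i _ do rewrite (addnBAC _ (leq_trans (ltnW (ltn_ord i))
  (leq_addr q c))).
rewrite prod_falling; last by rewrite -addnA leq_addr.
by rewrite -addnA addKn.
Qed.

End moments.

(** * Minors as determinants of Gaussian blocks *)

Section minors.
Context {R : realType}.

(** Two enumerations of the same finite set differ by a permutation. *)
Lemma injection_reorder (T : finType) N (e f : 'I_N -> T) :
  injective e -> injective f -> (forall i, f i \in codom e) ->
  exists s : 'S_N, forall i, f i = e (s i).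
Proof.
move=> e_inj f_inj fe.
have s_inj : injective (fun i => iinv (fe i)).
  by move=> i j /(congr1 e); rewrite !f_iinv => /f_inj.
by exists (perm s_inj) => i; rewrite permE f_iinv.
Qed.

Lemma det_minor_reorder r n N (e1 e2 f1 f2 : 'I_N -> 'I_r) (s1 s2 : 'S_N)
    (X : 'M[R]_(r, n)) :
  (forall i, f1 i = e1 (s1 i)) -> (forall i, f2 i = e2 (s2 i)) ->
  \det (rowsub f1 X *m (rowsub f2 X)^T) =
  (-1) ^+ s1 * (-1) ^+ s2 * \det (rowsub e1 X *m (rowsub e2 X)^T).
Proof.
move=> h1 h2.
have row_permE' (e f : 'I_N -> 'I_r) (s : 'S_N) : (forall i, f i = e (s i)) ->
    rowsub f X = perm_mx s *m rowsub e X.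
  by move=> h; rewrite -row_permE; apply/matrixP => i j; rewrite !mxE h.
rewrite (row_permE' _ _ _ h1) (row_permE' _ _ _ h2) trmx_mul mulmxA.
by rewrite det_mulmx -mulmxA det_mulmx det_tr !det_perm mulrAC.
Qed.

Definition enum_row r m (I : {set 'I_r}) (hI : #|I| = m) (i : 'I_m) : 'I_r :=
  enum_val (cast_ord (esym hI) i).

Lemma enum_row_inj r m (I : {set 'I_r}) (hI : #|I| = m) :
  injective (enum_row hI).
Proof. by move=> i j /enum_val_inj/cast_ord_inj. Qed.

Lemma enum_rowP r m (I : {set 'I_r}) (hI : #|I| = m) i : enum_row hI i \in I.
Proof. exact: enum_valP. Qed.

Lemma mem_codom_enum_row r m (I : {set 'I_r}) (hI : #|I| = m) x :
  x \in I -> x \in codom (enum_row hI).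
Proof.
move=> xI; apply/codomP; exists (cast_ord hI (enum_rank_in xI x)).
by rewrite /enum_row cast_ordK enum_rankK_in.
Qed.

Lemma submatrix_gram r m n (I J : {set 'I_r}) (hI : #|I| = m) (hJ : #|J| = m)
    (X : 'M[R]_(r, n)) :
  submatrix hI hJ (X *m X^T) =
  rowsub (enum_row hI) X *m (rowsub (enum_row hJ) X)^T.
Proof.
apply/matrixP => i j; rewrite !mxE; apply: eq_bigr => k _.
by rewrite !mxE.
Qed.

(** The concatenation of two finite sequences. *)
Definition case_ord (S : Type) m n (f : 'I_m -> S) (g : 'I_n -> S)
    (i : 'I_(m + n)) : S :=
  match fintype.split i with inl a => f a | inr b => g b end.

Lemma case_ord_lshift (S : Type) m n (f : 'I_m -> S) (g : 'I_n -> S) i :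
  case_ord f g (lshift n i) = f i.
Proof. by rewrite /case_ord -[lshift _ _]/(unsplit (inl i)) unsplitK. Qed.

Lemma case_ord_rshift (S : Type) m n (f : 'I_m -> S) (g : 'I_n -> S) i :
  case_ord f g (rshift m i) = g i.
Proof. by rewrite /case_ord -[rshift _ _]/(unsplit (inr i)) unsplitK. Qed.

Lemma case_ord_inj (S : eqType) m n (f : 'I_m -> S) (g : 'I_n -> S) :
  injective f -> injective g -> (forall i j, f i != g j) ->
    injective (case_ord f g).
Proof.
move=> f_inj g_inj fg i j; rewrite -(splitK i) -(splitK j).
case: (fintype.split i) (fintype.split j) => [a|a] [b|b] /=;
  rewrite ?case_ord_lshift ?case_ord_rshift.
- by move/f_inj ->.
- by move=> e; case/eqP: (fg a b).
- by move=> e; case/eqP: (fg b a).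
- by move/g_inj ->.
Qed.

Lemma rowsub_case_ord r m1 m2 n (f : 'I_m1 -> 'I_r) (g : 'I_m2 -> 'I_r)
    (X : 'M[R]_(r, n)) :
  rowsub (case_ord f g) X = col_mx (rowsub f X) (rowsub g X).
Proof.
by apply/matrixP => i j; rewrite !mxE /case_ord; case: (fintype.split i) => k;
  rewrite mxE.
Qed.

(** The rows with index in [I :&: J], [I :\: J] and [J :\: I] are listed one
    after the other by an injection [f], so they form a Gaussian matrix. The
    sign [eps] compares this order with the increasing order in [I] and in
    [J]; for [k = 0] both permutations coincide. *)
Lemma law_minor (r n c k : nat) (I J : {set 'I_r})
    (hI : #|I| = (c + k)%N) (hJ : #|J| = (c + k)%N) :
  #|I :&: J| = c ->
  exists eps : R, [/\ eps = 1 \/ eps = -1, k = 0%N -> eps = 1 &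
  same_law (gaussian r n)
    (fun X : 'M[R]_(r, n) => \det (submatrix hI hJ (X *m X^T)))
    (gaussian c n \x (gaussian k n \x gaussian k n))%E
    (fun w => eps * \det (col_mx w.1 w.2.1 *m (col_mx w.1 w.2.2)^T))].
Proof.
move=> hc.
have hID : #|I :\: J| = k.
  by apply/eqP; rewrite -(eqn_add2l c) -{1}hc cardsID hI.
have hJD : #|J :\: I| = k.
  by apply/eqP; rewrite -(eqn_add2l c) -{1}hc finset.setIC cardsID hJ.
pose a := enum_row hc; pose b := enum_row hID; pose d := enum_row hJD.
have aI i : a i \in I by have := enum_rowP hc i;
  rewrite finset.in_setI => /andP[].
have aJ i : a i \in J by have := enum_rowP hc i;
  rewrite finset.in_setI => /andP[].
have bI i : b i \in I by have := enum_rowP hID i;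
  rewrite finset.in_setD => /andP[].
have bJ i : b i \notin J by have := enum_rowP hID i;
  rewrite finset.in_setD => /andP[].
have dI i : d i \notin I by have := enum_rowP hJD i;
  rewrite finset.in_setD => /andP[].
have dJ i : d i \in J by have := enum_rowP hJD i;
  rewrite finset.in_setD => /andP[].
have neq x y (K : {set 'I_r}) : x \in K -> y \notin K -> x != y.
  by move=> xK; apply: contraNneq => <-.
have ab_inj : injective (case_ord a b).
  by apply: case_ord_inj => [||i j]; [exact: enum_row_inj..|exact: neq (aJ i)
    (bJ j)].
have ad_inj : injective (case_ord a d).
  by apply: case_ord_inj => [||i j]; [exact: enum_row_inj..|exact: neq (aI i)
    (dI j)].
have bd_inj : injective (case_ord b d).
  by apply: case_ord_inj => [||i j]; [exact: enum_row_inj..|exact: neq (bI i)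
    (dI j)].
have f_inj : injective (case_ord a (case_ord b d)).
  apply: case_ord_inj => // [|i j]; first exact: enum_row_inj.
  rewrite /case_ord; case: (fintype.split j) => l;
    first exact: neq (aJ i) (bJ l).
  exact: neq (aI i) (dI l).
have [s1 h1] : exists s : 'S_(c + k), forall i,
  case_ord a b i = enum_row hI (s i).
  apply: injection_reorder => // [|i]; first exact: enum_row_inj.
  by apply: mem_codom_enum_row; rewrite /case_ord; case: (fintype.split i).
have [s2 h2] : exists s : 'S_(c + k), forall i,
  case_ord a d i = enum_row hJ (s i).
  apply: injection_reorder => // [|i]; first exact: enum_row_inj.
  by apply: mem_codom_enum_row; rewrite /case_ord; case: (fintype.split i).
exists ((-1) ^+ s1 * (-1) ^+ s2); split.
- by case: (odd_perm s1); case: (odd_perm s2);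
  rewrite ?expr1 ?expr0 ?mulr1 ?mulrNN ?mul1r ?mulr1; [left|right|right|left].
- move=> k0; have IJ : I = J.
    have k0' (K : {set 'I_r}) : #|K| = k -> K = finset.set0 by rewrite k0 =>
      /eqP; rewrite cards_eq0 => /eqP.
    apply/eqP; rewrite finset.eqEsubset -!finset.setD_eq0.
    by rewrite (k0' _ hID) (k0' _ hJD) !eqxx.
  have eIJ i : enum_row hI i = enum_row hJ i.
    by clear -IJ; subst J; congr enum_val; apply: val_inj.
  have -> : s1 = s2.
    apply/permP => i; apply: (@enum_row_inj _ _ _ hJ).
    rewrite -h2 -eIJ -h1 /case_ord; case: (fintype.split i) => // l.
    by exfalso; have := ltn_ord l; move: (nat_of_ord l) => x; rewrite k0.
  by rewrite -signr_addb addbb.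
(* As [eps * eps = 1], the relation between the two minors can be inverted. *)
set eps := _ * _.
have eps2 : eps * eps = 1 by rewrite mulrACA -!expr2 !sqrr_sign mulr1.
(* The minor as a function of the single Gaussian matrix [[A; B; C]]. *)
pose g (Y : 'M[R]_(c + (k + k), n)) :=
  eps * \det (col_mx (usubmx Y) (usubmx (dsubmx Y)) *m
              (col_mx (usubmx Y) (dsubmx (dsubmx Y)))^T).
have mg : measurable_fun [set: 'M[R]_(c + (k + k), n)] g.
  apply: measurable_funM; first exact: measurable_cst.
  by apply: measurable_det_gram; apply: measurable_col_mx;
    apply/measurable_fun_mxP => i j; under eq_fun do rewrite !mxE;
    exact: measurable_mx_entry.
have h3 := same_law_comp mg (gaussian_rowsub n f_inj).
have mcol : measurable_fun [set: 'M[R]_(c, n) * 'M[R]_(k + k, n)]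
    (fun w => col_mx w.1 w.2) by exact: measurable_col_mx.
have h4 := same_law_comp mcol (same_law_pair
  (same_law_refl (gaussian c n) (@measurable_id _ _ setT))
    (@gaussian_col R k k n)).
have h5 := same_law_comp mg (same_law_sym (same_law_trans h4 (@gaussian_col R c
  (k + k) n))).
have h6 := same_law_trans h3 h5.
apply: same_law_ext h6 => [X|w] /=.
  rewrite /g !rowsub_case_ord !(col_mxKu, col_mxKd) -!rowsub_case_ord.
  by rewrite (det_minor_reorder X h1 h2) mulrA eps2 mul1r submatrix_gram.
by rewrite /g !(col_mxKu, col_mxKd).
Qed.

End minors.

(** * The representation of a minor *)

Section representation.
Context {R : realType}.

Lemma measurable_sqrt : measurable_fun [set: R] (Num.sqrt : R -> R).
Proof. by apply: continuous_measurable_fun; exact: sqrt_continuous. Qed.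

(** Combines [law_minor], [law_det_gram2] and [law_det_cross], and removes
    the sign: it is [1] if [k = 0], and otherwise it is absorbed by [\det
    Z]. *)
Lemma law_minor_product (r c k q : nat) (I J : {set 'I_r})
    (hI : #|I| = (c + k)%N) (hJ : #|J| = (c + k)%N) :
  #|I :&: J| = c ->
  same_law (gaussian r (c + (k + q)))
    (fun X => \det (submatrix hI hJ (X *m X^T)) : R)
    (gaussian c (c + (k + q)) \x (gaussian k (k + q) \x gaussian k k))%E
    (fun w => \det (w.1 *m w.1^T) *
      (Num.sqrt (\det (w.2.1 *m w.2.1^T)) * \det w.2.2)).
Proof.
move=> hc; have [eps [eps1 epsk h1]] := law_minor (R := R) (c + (k + q))
  hI hJ hc.
have meps (e : R) : measurable_fun [set: R] (fun x =>
  e * x) by exact: measurable_funM.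
have h2 := same_law_comp (meps eps) (law_det_gram2 (R := R) c k (k + q)).
have mgram : measurable_fun [set: 'M[R]_(c, c + (k + q))] (fun A =>
  \det (A *m A^T)).
  exact: measurable_det_gram.
have mM : measurable_fun [set: R * R] (fun w => w.1 * w.2).
  by apply: measurable_funM; [exact: measurable_fst|exact: measurable_snd].
have h3 := same_law_comp (measurableT_comp (meps eps) mM)
  (same_law_pair (same_law_refl (gaussian c (c + (k + q))) mgram)
    (law_det_cross (R := R) k q)).
apply: same_law_trans h1 _; apply: same_law_trans h2 _;
  apply: same_law_trans h3 _.
have hsgn : same_law (gaussian k k) (fun Z =>
  eps * \det Z) (gaussian k k) (fun Z => \det Z : R).
  have md : measurable_fun [set: 'M[R]_k] (fun Z =>
    \det Z) by exact: measurable_det.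
  case: eps1 => e.
    by rewrite e; apply: same_law_ext (same_law_refl _ md) => // Z;
      rewrite mul1r.
  have [k0|k0] := posnP k.
    rewrite (epsk k0); apply: same_law_ext (same_law_refl _ md) => // Z.
    by rewrite mul1r.
  by rewrite e; apply: same_law_ext (det_gaussian_sym k0) => // Z;
    rewrite mulN1r.
have msq : measurable_fun [set: 'M[R]_(k, k + q)] (fun B =>
  Num.sqrt (\det (B *m B^T))).
  by apply: measurableT_comp measurable_sqrt _; exact: measurable_det_gram.
have h4 := same_law_comp mM (same_law_pair (same_law_refl (gaussian k (k + q))
  msq) hsgn).
have h5 := same_law_comp mM (same_law_pair (same_law_refl (gaussian c (c + (k +
  q))) mgram) h4).
by apply: same_law_ext h5 => // w /=; ring.
Qed.

Lemma chi_square_sqnorm d (T : measurableType d) (P : probability T R) k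
    (X : T -> R) :
  chi_square P k X -> same_law P X (gaussian 1 k) (@sqnorm R k).
Proof.
move=> [d' [T' [P' [G [indG norG hX]]]]]; apply: same_law_trans hX _.
have e_inj : injective (fun ij : 'I_1 * 'I_k => ij.2).
  by move=> [i i'] [j j'] /= ->; rewrite (ord1 i) (ord1 j).
have h := same_law_independent (e := fun _ j => j) (mu := fun _ _ => normal_law)
  e_inj indG (fun _ j => norG j).
apply: same_law_ext (same_law_comp (@measurable_sqnorm R k) h) => // w.
by rewrite /= sqnormE; apply: eq_bigr => i _; rewrite mxE.
Qed.

(** The inverse of [mxvec_index]. *)
Definition unvec_index m n (l : 'I_(m * n)) : 'I_m * 'I_n :=
  enum_val (cast_ord (esym (mxvec_cast m n)) l).

Lemma unvec_indexK m n l :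
  mxvec_index (@unvec_index m n l).1 (unvec_index l).2 = l.
Proof.
by rewrite /mxvec_index /unvec_index -surjective_pairing enum_valK cast_ordKV.
Qed.

Lemma mxvec_indexK m n i j : @unvec_index m n (mxvec_index i j) = (i, j).
Proof. by rewrite /mxvec_index /unvec_index cast_ordK enum_rankK. Qed.

Lemma gaussian_vec_mx m n :
  same_law (gaussian 1 (m * n)) vec_mx
    (gaussian m n : probability 'M[R]_(m, n) R) id.
Proof.
apply: product_mx_unique.
  apply/measurable_fun_mxP => i j; under eq_fun do rewrite mxE.
  exact: measurable_mx_entry.
move=> A mA.
have h := @gaussianP R 1 (m * n) (fun _ l =>
  A (unvec_index l).1 (unvec_index l).2) (fun _ _ => mA _ _).
apply: etrans (etrans h _).
  rewrite /pushforward; congr (gaussian _ _ _); apply/seteqP; split => v /= hv.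
    by move=> i l; have := hv (unvec_index l).1 (unvec_index l).2;
      rewrite mxE unvec_indexK ord1.
  by move=> i j; have := hv 0 (mxvec_index i j); rewrite mxE mxvec_indexK.
rewrite big_ord1 pair_bigA/= (reindex (fun ij : 'I_m * 'I_n =>
  mxvec_index ij.1 ij.2))/=.
  by apply: eq_bigr => -[i j] _; rewrite mxvec_indexK.
exists (@unvec_index m n) => [[i j] _|l _]; first exact: mxvec_indexK.
exact: unvec_indexK.
Qed.

Lemma product_mx_eq m n (mu nu : 'I_m -> 'I_n -> probability R R) :
  (forall i j, mu i j = nu i j) -> product_mx mu = product_mx nu.
Proof. by move=> h; congr product_mx; apply/funext => i; apply/funext => j. Qed.

(** The variables [V i] and the entries of [Z] are put in a single row, so
    that their joint law is the product of three blocks: [V i] for [i < c],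
    the other [V i], and [Z]. Then [law_prod_chi] applies to the first two
    blocks, to the second one with [k + q] in place of [c + (k + q)]. *)
Lemma law_representation (c k q : nat) d (T : measurableType d)
    (P : probability T R) (V : 'I_(c + k) -> {RV P >-> R})
    (Z : {RV P >-> 'M[R]_k}) :
  mutually_independent P
    (fun x : 'I_(c + k) + 'I_k * 'I_k =>
       match x with inl i => V i : T -> R | inr (i, j) => fun w =>
         Z w i j end) ->
  (forall i : 'I_(c + k), chi_square P (c + (k + q) - i) (V i)) ->
  (forall i j, std_normal P (fun w => Z w i j)) ->
  same_law P (fun w => (\prod_(i < c + k | (i < c)%N) V i w) *
                       (\prod_(i < c + k | (c <= i)%N) Num.sqrt (V i w)) *
                       \det (Z w))
    (gaussian c (c + (k + q)) \x (gaussian k (k + q) \x gaussian k k))%E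
    (fun w => \det (w.1 *m w.1^T) *
      (Num.sqrt (\det (w.2.1 *m w.2.1^T)) * \det w.2.2)).
Proof.
move=> ind chiV norZ.
(* The order of the variables in the row; the last [k * k] positions hold the
   entries of [Z] in the order of [mxvec]. *)
pose e (_ : 'I_1) : 'I_(c + (k + k * k)) -> 'I_(c + k) + 'I_k * 'I_k :=
  case_ord (fun a => inl (lshift k a))
    (case_ord (fun b => inl (rshift c b)) (fun l => inr (unvec_index l))).
pose nu (x : 'I_(c + k) + 'I_k * 'I_k) : probability R R :=
  match x with inl i => distribution P (V i) | inr _ => normal_law end.
have e_inj : injective (fun ij : 'I_1 * 'I_(c + (k + k * k)) => e ij.1 ij.2).
  have inj : injective (e 0).
    apply: case_ord_inj.
    - by move=> x y h; apply: (@lshift_inj c k); apply: inl_inj h.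
    - apply: case_ord_inj => //.
      + by move=> x y h; apply: (@rshift_inj c k); apply: inl_inj h.
      + move=> x y h; rewrite -[x]unvec_indexK -[y]unvec_indexK.
        by rewrite (inr_inj h).
    move=> x y.
    rewrite /case_ord; case: (fintype.split y) => // z.
    by apply/eqP => h; have /eqP := inl_inj h; rewrite eq_lrshift.
  by move=> [i i'] [j j'] /= /inj ->; rewrite (ord1 i) (ord1 j).
have h0 := same_law_independent e_inj ind (mu := fun i j => nu (e i j)).
have {}h0 : same_law P (fun w => row_mx (\row_a V (lshift k a) w)
    (row_mx (\row_b V (rshift c b) w) (mxvec (Z w)))) (product_mx (fun i j =>
      nu (e i j))) id.
  apply: same_law_ext (h0 _) => // [w|i j]; last first.
    case: (e i j) => [l|[l l']]; last exact: norZ.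
    by split.
  apply/rowP => j; rewrite mxE /e /case_ord [RHS]mxE;
    case: (fintype.split j) => l.
    by rewrite mxE.
  rewrite mxE; case: (fintype.split l) => l'; first by rewrite mxE.
  rewrite -[l' in RHS]unvec_indexK mxvecE.
  by case: (unvec_index l').
have h1 := same_law_sym (product_mx_row (fun i (j : 'I_(c + (k + k * k))) =>
  nu (e i j))).
have h2 := same_law_sym (product_mx_row (fun i (j : 'I_(k + k * k)) =>
  nu (e i (rshift c j)))).
have e1 : product_mx (fun i j => nu (e i (lshift (k + k * k) j))) =
    product_mx (fun _ : 'I_1 => fun a => distribution P (V (lshift k a))).
  by apply: product_mx_eq => i j; rewrite /e case_ord_lshift.
have e2 : product_mx (fun i j => nu (e i (rshift c (lshift (k * k) j)))) =
    product_mx (fun _ : 'I_1 => fun b => distribution P (V (rshift c b))).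
  by apply: product_mx_eq => i j; rewrite /e case_ord_rshift case_ord_lshift.
have e3 : product_mx (fun i j => nu (e i (rshift c (rshift k j)))) =
  gaussian 1 (k * k).
  by apply: product_mx_eq => i j; rewrite /e !case_ord_rshift.
rewrite e1 in h1; rewrite e2 e3 in h2.
have hV i : same_law (distribution P (V i)) id
    (gaussian 1 (c + (k + q) - i)) (@sqnorm R _).
  apply: same_law_trans (chi_square_sqnorm (chiV i)).
  by split => //; exact: measurable_funP.
have c1 : same_law (product_mx (fun _ : 'I_1 => fun a =>
  distribution P (V (lshift k a))))
    (fun v => \prod_i v 0 i) (gaussian c (c + (k + q))) (fun A =>
      \det (A *m A^T)).
  apply: (law_prod_chi (h := id)) => //; first exact: leq_addr.
  by move=> i; exact: hV (lshift k i).
have c2 : same_law (product_mx (fun _ : 'I_1 => fun b =>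
  distribution P (V (rshift c b))))
    (fun v => \prod_i Num.sqrt (v 0 i)) (gaussian k (k + q))
    (fun A => Num.sqrt (\det (A *m A^T))).
  apply: (law_prod_chi (h := Num.sqrt)) => //.
  - exact: measurable_sqrt.
  - exact: sqrtr1.
  - by move=> x y x0; rewrite sqrtrM.
  - exact: leq_addr.
  by move=> i; have := hV (rshift c i); rewrite /= subnDl.
have mM : measurable_fun [set: R * R] (fun w => w.1 * w.2).
  by apply: measurable_funM; [exact: measurable_fst|exact: measurable_snd].
have mdet : measurable_fun [set: 'M[R]_k] (fun A =>
  \det A) by exact: measurable_det.
have c3 := same_law_comp mdet (gaussian_vec_mx k k).
have c23 := same_law_comp mM (same_law_pair c2 c3).
(* The part of the product that depends on the last two blocks of the row. *)
pose g2 (u : 'rV[R]_(k + k * k)) :=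
  (\prod_b Num.sqrt (u 0 (lshift (k * k) b))) * \det (vec_mx (rsubmx u)).
have mg2 : measurable_fun [set: 'rV[R]_(k + k * k)] g2.
  apply: measurable_funM.
    apply: measurable_prod => b _; apply: measurableT_comp measurable_sqrt _.
    exact: measurable_mx_entry.
  apply: measurable_det; apply/measurable_fun_mxP => i j.
  by under eq_fun do rewrite !mxE; exact: measurable_mx_entry.
have c4 : same_law (product_mx (fun i j => nu (e i (rshift c j)))) g2
    (gaussian k (k + q) \x gaussian k k)%E
    (fun w => Num.sqrt (\det (w.1 *m w.1^T)) * \det w.2).
  apply: same_law_trans (same_law_comp mg2 h2) _;
    apply: same_law_ext c23 => // w /=.
  rewrite /g2 row_mxKr; congr (_ * _); apply: eq_bigr => b _.
  by rewrite row_mxEl.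
have c5 := same_law_comp mM (same_law_pair c1 c4).
pose g (v : 'rV[R]_(c + (k + k * k))) :=
  (\prod_a v 0 (lshift (k + k * k) a)) * g2 (rsubmx v).
have mg : measurable_fun [set: 'rV[R]_(c + (k + k * k))] g.
  apply: measurable_funM.
    by apply: measurable_prod => a _; exact: measurable_mx_entry.
  apply: measurableT_comp mg2 _; apply/measurable_fun_mxP => i j.
  by under eq_fun do rewrite !mxE; exact: measurable_mx_entry.
have c6 := same_law_comp mg (same_law_trans h0 h1).
apply: same_law_trans (same_law_trans (same_law_ext _ _ c6) _) c5.
- move=> w; rewrite /= /g /g2 !row_mxKr mxvecK mulrA; congr (_ * _ * _).
    rewrite big_split_ord/= [X in _ * X]big1 ?mulr1 => [|i]; last first.
      by rewrite ltnNge leq_addr.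
    by apply: eq_big => [i|i _]; rewrite ?ltn_ord// row_mxEl mxE.
  rewrite big_split_ord/= [X in X * _]big1 ?mul1r => [|i]; last first.
    by rewrite leqNgt ltn_ord.
  by apply: eq_big => [i|i _]; rewrite ?leq_addr// row_mxEl mxE.
- by move=> w; reflexivity.
have mg' : measurable_fun [set: 'rV[R]_c * 'rV[R]_(k + k * k)] (fun w =>
  g (row_mx w.1 w.2)).
  by apply: measurableT_comp mg _; exact: measurable_row_mx.
apply: same_law_ext (same_law_refl _ mg') => // w /=.
by rewrite /g row_mxKr; congr (_ * _); apply: eq_bigr => a _; rewrite row_mxEl.
Qed.

End representation.

(** * First two moments of a minor *)

Section expectation_and_law.
Context {R : realType}.

(** Positive and negative parts have equal integrals, finite or not. *)
Lemma same_law_expectation d1 d2 (T1 : measurableType d1)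
    (T2 : measurableType d2)
    (P1 : probability T1 R) (X1 : T1 -> R)
    (P2 : probability T2 R) (X2 : T2 -> R) :
  same_law P1 X1 P2 X2 ->
  (\int[P1]_x (X1 x)%:E = \int[P2]_x (X2 x)%:E)%E.
Proof.
move=> h; rewrite integralE [RHS]integralE.
have mE : measurable_fun [set: R] (@EFin R) by exact/measurable_EFinP.
congr (_ - _)%E.
  under eq_integral do rewrite funeposE.
  under [RHS]eq_integral do rewrite funeposE.
  have mf : measurable_fun [set: R] (fun x : R =>
    maxe x%:E 0) by exact: measurable_maxe.
  have f0 (x : R) : (0 <= maxe x%:E 0)%E by rewrite le_max lexx orbT.
  exact: (same_law_integral mf f0 h).
under eq_integral do rewrite funenegE.
under [RHS]eq_integral do rewrite funenegE.
have mf : measurable_fun [set: R] (fun x : R => maxe (- x%:E)%E 0).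
  by apply: measurable_maxe => //; exact: measurableT_comp.
have f0 (x : R) : (0 <= maxe (- x%:E)%E 0)%E by rewrite le_max lexx orbT.
exact: (same_law_integral mf f0 h).
Qed.

Lemma square_integrable d (T : measurableType d) (P : probability T R)
    (X : T -> R) (a : R) :
  measurable_fun [set: T] X -> (\int[P]_x (X x ^+ 2)%:E = a%:E)%E ->
  X \in Lfun P 2%:E.
Proof.
move=> mX hX; rewrite inE; apply/andP; split; rewrite inE//=.
rewrite /finite_norm unlock /Lnorm; apply: poweR_lty.
rewrite (_ : (\int[P]_x _)%E = a%:E) ?ltry// -hX; apply: eq_integral => x _.
by rewrite /= powR_mulrn// real_normK ?num_real.
Qed.

Lemma law_variance d (T : measurableType d) (P : probability T R)
    (X : T -> R) (a b : R) :
  measurable_fun [set: T] X -> ('E_P[fun w => (X w ^+ 2)%R] = a%:E)%E ->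
  ('E_P[X] = b%:E)%E -> ('V_P[X] = (a - b ^+ 2)%:E)%E.
Proof.
move=> mX hX eX; rewrite varianceE; last first.
  by apply: (square_integrable (a := a) mX); rewrite -hX unlock.
by rewrite eX -EFin_expe EFinB; congr (_ - _)%E.
Qed.

(** The bound on the second moment ensures that the mean is finite, without
    which [m = - m] would not give [m = 0]. *)
Lemma symmetric_expectation d (T : measurableType d) (P : probability T R)
    (X : T -> R) (a : R) :
  ('E_P[fun w => (X w ^+ 2)%R] = a%:E)%E ->
  same_law P X P (fun w => - X w) -> ('E_P[X] = 0)%E.
Proof.
move=> hX h; have [mX _ _] := h.
have iX : P.-integrable setT (EFin \o X).
  apply/Lfun1_integrable; apply: Lfun_subset12;
    first by rewrite fin_num_measure.
  by apply: (square_integrable (a := a) mX); rewrite -hX unlock.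
have := same_law_expectation h; rewrite unlock.
under [RHS]eq_integral do rewrite EFinN.
rewrite integralN/=; last exact: integrable_add_def.
have : (\int[P]_x (X x)%:E)%E \is a fin_num by exact: integrable_fin_num.
case: (\int[P]_x (X x)%:E)%E => // x _ [] e; congr EFin; lra.
Qed.

End expectation_and_law.

Section minor_moments.
Context {R : realType} (c k q : nat).
Let n := (c + (k + q))%N.
Let prodrv (w : 'M[R]_(c, n) * ('M[R]_(k, k + q) * 'M[R]_k)) : R :=
  \det (w.1 *m w.1^T) * (Num.sqrt (\det (w.2.1 *m w.2.1^T)) * \det w.2.2).
Let lawP : probability ('M[R]_(c, n) * ('M[R]_(k, k + q) * 'M[R]_k))%type R :=
  (gaussian c n \x (gaussian k (k + q) \x gaussian k k))%E.

Let mgram a b : measurable_fun [set: 'M[R]_(a, b)] (fun A => \det (A *m A^T)).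
Proof. exact: measurable_det_gram. Qed.

(** Since [\det Z ^+ 2 = \det (Z Z^T)], all three factors are moments of
    Gram determinants, of orders two, one and one. *)
Lemma minor_second_moment :
  (\int[lawP]_w (prodrv w ^+ 2)%:E =
   (n`!%:R / (n - (c + k))`!%:R * ((n + 2)`!%:R / (n + 2 - c)`!%:R)
     * k`!%:R)%:E)%E.
Proof.
(* The square root disappears in the square as Gram determinants are
   nonnegative; the absolute value is the form in which [abs_det_gram_moment]
   is stated. *)
transitivity (\int[lawP]_w (\det (w.1 *m w.1^T) ^+ 2 *
   (\det (w.2.1 *m w.2.1^T) * `|\det (w.2.2 *m w.2.2^T)|))%:E)%E.
  apply: eq_integral => w _; congr EFin; rewrite /prodrv !exprMn.
  by rewrite sqr_sqrtr ?det_gram_ge0// det_mulmx det_tr -expr2 ger0_norm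
    ?sqr_ge0.
have mabs : measurable_fun [set: 'M[R]_k] (fun A => `|\det (A *m A^T)|).
  by apply: measurableT_comp => //; exact: mgram.
rewrite (integral_product (gaussian c n) (gaussian k (k + q) \x gaussian k k)%E
  (f := fun A : 'M[R]_(c, n) => \det (A *m A^T) ^+ 2)
  (g := fun w : 'M[R]_(k, k + q) * 'M[R]_k =>
    \det (w.1 *m w.1^T) * `|\det (w.2 *m w.2^T)|)); last 4 first.
- by apply: measurable_funX; exact: mgram.
- apply: measurable_funM.
    by apply: measurable_det_gram; exact: measurable_fst.
  by apply: measurableT_comp => //; apply: measurable_det_gram;
    exact: measurable_snd.
- by move=> A; exact: sqr_ge0.
- by move=> w; rewrite mulr_ge0// det_gram_ge0.
rewrite (integral_product (gaussian k (k + q)) (gaussian k k)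
  (f := fun A : 'M[R]_(k, k + q) => \det (A *m A^T))
  (g := fun A : 'M[R]_k => `|\det (A *m A^T)|)) //; last first.
  by move=> A; exact: det_gram_ge0.
rewrite det_gram_moment2 det_gram_moment1.
have hZ := abs_det_gram_moment (R := R) (s := 1) sqnorm_moment1 (leqnn k).
rewrite prod_falling// subnn fact0 divr1 in hZ.
rewrite (_ : (\int[gaussian k k]_x _)%E = k`!%:R%:E); last first.
  by rewrite -hZ; apply: eq_integral => A _; rewrite expr1.
rewrite -!EFinM; congr EFin.
have -> : (n - (c + k) = q)%N by rewrite /n addnA addKn.
have -> : (n + 2 - c = k + q + 2)%N by rewrite /n -addnA addKn.
have kq0 : ((k + q)`!%:R != 0 :> R) by rewrite pnatr_eq0 -lt0n fact_gt0.
rewrite -/n; have q0 : (q`!%:R != 0 :> R) by rewrite pnatr_eq0 -lt0n fact_gt0.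
have kq20 : ((k + q + 2)`!%:R != 0 :> R) by rewrite pnatr_eq0 -lt0n fact_gt0.
by field; rewrite q0 kq0 kq20.
Qed.

(** For [k = 0] the determinants of the last two matrices are [1]. *)
Lemma minor_first_moment0 : k = 0%N ->
  (\int[lawP]_w (prodrv w)%:E = (n`!%:R / (n - (c + k))`!%:R)%:E)%E.
Proof.
move=> k0; transitivity (\int[lawP]_w (\det (w.1 *m w.1^T))%:E)%E.
  apply: eq_integral => w _; congr EFin; rewrite /prodrv.
  case: w => A [B C] /=.
  have -> : \det (B *m B^T) = 1 by move: B; rewrite k0 => B; rewrite det_mx00.
  have -> : \det C = 1 by move: C; rewrite k0 => C; rewrite det_mx00.
  by rewrite sqrtr1 !mulr1.
transitivity (\int[@gaussian R c n]_A (\det (A *m A^T))%:E)%E.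
  apply: same_law_expectation.
  have h := same_law_comp (@mgram c n) (same_law_fst (gaussian c n)
    (gaussian k (k + q) \x gaussian k k)%E).
  exact: h.
rewrite det_gram_moment1; congr (_ / _%:R)%:E; congr _`!.
by rewrite /n addnA addKn k0.
Qed.

Lemma minor_symmetric : (0 < k)%N ->
  same_law lawP prodrv lawP (fun w => - prodrv w).
Proof.
move=> k0.
have mM : measurable_fun [set: R * R] (fun w => w.1 * w.2).
  by apply: measurable_funM; [exact: measurable_fst|exact: measurable_snd].
have msq : measurable_fun [set: 'M[R]_(k, k + q)] (fun B =>
  Num.sqrt (\det (B *m B^T))).
  by apply: measurableT_comp (measurable_sqrt) (@mgram _ _).
have h4 := same_law_comp mM (same_law_pair (same_law_refl (gaussian k (k + q))
  msq)
  (same_law_sym (det_gaussian_sym (R := R) k0))).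
have h5 := same_law_comp mM (same_law_pair (same_law_refl (gaussian c n)
  (@mgram _ _)) h4).
by apply: same_law_ext h5 => w //=; rewrite /prodrv !mulrN.
Qed.

End minor_moments.

(** * Minors of a Wishart matrix *)

Lemma law_minor_wishart (R : realType) (r n c k : nat) (I J : {set 'I_r})
    (hI : #|I| = (c + k)%N) (hJ : #|J| = (c + k)%N) d (T : measurableType d)
    (P : probability T R) (W : T -> 'M[R]_r) :
  wishart_id P n W ->
  same_law P (fun w => \det (submatrix hI hJ (W w)))
    (gaussian r n) (fun X => \det (submatrix hI hJ (X *m X^T)) : R).
Proof.
move=> [d' [T' [P' [X [indX norX hW]]]]].
have msub : measurable_fun [set: 'M[R]_r] (fun M => \det (submatrix hI hJ M)).
  apply: measurable_det; apply/measurable_fun_mxP => i j.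
  by under eq_fun do rewrite mxE; exact: measurable_mx_entry.
have hX := gaussian_columns (@measurable_funP _ _ _ _ setT X) indX norX.
have mgram : measurable_fun [set: 'M[R]_(r, n)] (fun X =>
  \det (submatrix hI hJ (X *m X^T))).
  apply: (measurableT_comp msub); apply: measurable_mulmx => //.
  exact: measurable_trmx.
exact: same_law_trans (same_law_comp msub hW) (same_law_comp mgram hX).
Qed.

Unset Implicit Arguments.

Theorem theorem4p4 (R : realType) (r m n c : nat)
    (hr : (1 <= r)%N) (hm1 : (1 <= m)%N) (hmr : (m <= r)%N) (hn : (r <= n)%N)
    (I J : {set 'I_r}) (hI : #|I| = m) (hJ : #|J| = m)
    (hc : #|I :&: J| = c)
    (d : measure_display) (T : measurableType d) (P : probability T R)
    (W : {RV P >-> 'M[R]_r}) (hW : wishart_id P n W) :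
  [/\ forall (d' : measure_display) (T' : measurableType d')
        (P' : probability T' R) (V : 'I_m -> {RV P' >-> R})
        (Z : {RV P' >-> 'M[R]_(m - c)}),
        mutually_independent P'
          (fun k : 'I_m + 'I_(m - c) * 'I_(m - c) =>
             match k with
             | inl i => V i : T' -> R
             | inr (i, j) => fun w => Z w i j
             end) ->
        (* The index i runs from 0, so V i has n - (i + 1) + 1 degrees of
           freedom. *)
        (forall i : 'I_m, chi_square P' (n - i) (V i)) ->
        (forall i j, std_normal P' (fun w => Z w i j)) ->
        same_law P (fun w => \det (submatrix hI hJ (W w)))
          P' (fun w => (\prod_(i < m | (i < c)%N) V i w) *
                       (\prod_(i < m | (c <= i)%N) Num.sqrt (V i w)) *
                       \det (Z w)),
      ('E_P[fun w => (\det (submatrix hI hJ (W w)) ^+ 2)%R] =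
        (n`!%:R / (n - m)`!%:R * ((n + 2)`!%:R / (n + 2 - c)`!%:R) *
         (m - c)`!%:R)%:E)%E,
      I = J ->
        ('V_P[fun w => (\det (submatrix hI hJ (W w)))%R] =
          (n`!%:R / (n - m)`!%:R *
           ((n + 2)`!%:R / (n + 2 - m)`!%:R - n`!%:R / (n - m)`!%:R))%:E)%E &
      (c < m)%N ->
        ('V_P[fun w => (\det (submatrix hI hJ (W w)))%R] =
          (n`!%:R / (n - m)`!%:R * ((n + 2)`!%:R / (n + 2 - c)`!%:R) *
           (m - c)`!%:R)%:E)%E].
Proof.
have cm : (c <= m)%N by rewrite -hI -hc subset_leq_card// subsetIl.
have [k mE] : exists k, m = (c + k)%N by exists (m - c)%N; rewrite subnKC.
have [q nE] : exists q, n = (c + (k + q))%N.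
  by exists (n - m)%N; rewrite addnA -mE subnKC// (leq_trans hmr).
move: hI hJ hm1 hmr cm; rewrite {m}mE => hI hJ hm1 hmr cm.
subst n; rewrite addKn.
have hD := same_law_trans (law_minor_wishart hI hJ hW)
  (law_minor_product q hI hJ hc).
have [mD _ _] := hD.
have sq : measurable_fun [set: R] (fun x : R => x ^+ 2).
  exact: measurable_funX.
have E2 := minor_second_moment (R := R) c k q.
rewrite -(same_law_moment (same_law_comp sq hD)) /= in E2; last 2 first.
- by move=> w; exact: sqr_ge0.
- by move=> w; exact: sqr_ge0.
have expectE (X : T -> R) : ('E_P[X] = \int[P]_w (X w)%:E)%E by rewrite unlock.
have eE2 := etrans (expectE (fun w => \det (submatrix hI hJ (W w)) ^+ 2)) E2.
split.
- move=> d' T' P' V Z ind chiV norZ.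
  exact: same_law_trans hD (same_law_sym (law_representation ind chiV norZ)).
- exact: eE2.
- move=> IJ; have k0 : k = 0%N.
    apply/eqP; rewrite -(eqn_add2l c) addn0 -hI -hc IJ finset.setIid.
    by rewrite eqxx.
  have E1 := etrans (expectE _)
    (etrans (same_law_expectation hD) (minor_first_moment0 (R := R) c q k0)).
  rewrite (law_variance mD eE2 E1); congr EFin.
  by rewrite k0 addn0 fact0 mulr1 mulrBr expr2.
move=> ck; have k0 : (0 < k)%N by rewrite -(ltn_add2l c) addn0.
have E1 : ('E_P[fun w => (\det (submatrix hI hJ (W w)))%R] = 0%:E)%E.
  apply: symmetric_expectation eE2 _.
  have mN : measurable_fun [set: R] (fun x : R => - x).
    exact: oppr_measurable.
  have hN := same_law_comp mN (same_law_sym hD).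
  have hS := minor_symmetric (R := R) c q k0.
  exact: same_law_trans hD (same_law_trans hS hN).
by rewrite (law_variance mD eE2 E1) expr0n subr0.
Qed.
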